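(* Let $G,H$ be finitely generated groups such that $G$ simulates $H$. Then: (1) $\mathfrak{M}_{\mathtt{SOF}}(G)\supset\mathfrak{M}_{\mathtt{EFF}}(H)$. (2) If $H$ is infinite and recursively presented, then $\mathfrak{M}_{\mathtt{SFT}}(G)$ contains a Medvedev degree which is bounded below by the maximal $\Pi_1^0$ Medvedev degree. (3) If $H$ is infinite and has decidable word problem, then $\mathfrak{M}_{\mathtt{SOF}}(G)$ contains the set of all $\Pi_1^0$ Medvedev degrees.
   Context: Alphabets are finite. For a group $G$ and alphabet $A$, $A^G=\{x\colon G\to A\}$ carries the prodiscrete topology and the shift action $(gx)(h)=x(g^{-1}h)$. A $G$-subshift is a closed $G$-invariant set $X\subset A^G$. For finite $F\subset G$ and a pattern $p\in A^F$ let $[p]=\{x\in A^G: x|_F=p\}$. $X$ is a subshift of finite type (SFT) if there is a finite set $\mathcal F$ of patterns with $X=\{x: gx\notin[p]\ \forall g\in G,\ p\in\mathcal F\}$. A subshift is sofic if it is the image of an SFT under a continuous $G$-equivariant map. Medvedev degrees: for $P,Q\subset\{0,1\}^{\mathbb N}$ write $P\le Q$ if there is a partial computable function $\Psi$ on $\{0,1\}^{\mathbb N}$ (a Turing functional) defined on all of $Q$ with $\Psi(Q)\subset P$. The Medvedev degree $m(P)$ is the class of $P$ under the equivalence $P\le Q\le P$; degrees are ordered by $\le$. A $\Pi_1^0$ Medvedev degree is the degree of a nonempty effectively closed ($\Pi^0_1$) subset of $\{0,1\}^{\mathbb N}$; among these there is a largest one, the maximal $\Pi_1^0$ Medvedev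 degree. For a group $G$ with finite generating set $S$, free group $F(S)$ and canonical epimorphism $\rho\colon F(S)\to G$, the pullback of a subshift $X\subset A^G$ is $\widehat X=\{x\circ\rho: x\in X\}\subset A^{F(S)}$. Via a computable bijection $\mathbb N\to F(S)$ and a fixed-length binary coding of $A$, $\widehat X$ is identified with a subset of $\{0,1\}^{\mathbb N}$, and $m(X):=m(\widehat X)$ (independent of choices). $X$ is effective if $\widehat X$ is a $\Pi_1^0$ set. $\mathfrak{M}_{\mathtt{SFT}}(G)$, $\mathfrak{M}_{\mathtt{SOF}}(G)$, $\mathfrak{M}_{\mathtt{EFF}}(G)$ denote the sets of degrees $m(X)$ where $X$ ranges over nonempty $G$-SFTs, nonempty sofic $G$-subshifts and nonempty effective $G$-subshifts, respectively. $G$ simulates $H$ if there is an epimorphism $\rho\colon G\to H$ such that for every effective $H$-subshift $X\subset A^H$ the pullback $\rho^*(X)=\{x\circ\rho:x\in X\}\subset A^G$ is a sofic $G$-subshift. A finitely generated group is recursively presented (resp. has decidable word problem) if the set of words in a finite generating set representing the identity is recursively enumerable (resp. decidable). *)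

(* Defs.v *)
From Stdlib Require Cantor.
From mathcomp Require Import all_boot finmap.
From mathcomp Require Import boolp classical_sets cardinality topology.

Set Implicit Arguments.
Unset Strict Implicit.
Unset Printing Implicit Defensive.

Local Open Scope classical_set_scope.

(* Partial recursive functionals, presented with unary programs on pairs:
   [nat * nat] is identified with [nat] through [Cantor.to_nat]. *)
Inductive code : Type :=
| Zero | Succ | Left | Right | Oracle
| Pair of code & code
| Comp of code & code
| PrimRec of code & code
| Mu of code.

Definition npair (a b : nat) : nat := Cantor.to_nat (a, b).

(* [run o c n r]: the program [c] with oracle [o] halts on [n] with output
   [r].  In the primitive recursion case, [s] is the list of intermediate
   values: s 0 = f(a) and s (i+1) = g(a, (i, s i)). *)
Fixpoint run (o : nat -> bool) (c : code) (n r : nat) : Prop :=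
  match c with
  | Zero => r = 0
  | Succ => r = n.+1
  | Left => r = (Cantor.of_nat n).1
  | Right => r = (Cantor.of_nat n).2
  | Oracle => r = o n
  | Pair f g => exists a b, [/\ run o f n a, run o g n b & r = npair a b]
  | Comp f g => exists2 m, run o g n m & run o f m r
  | PrimRec f g =>
      let: (a, k) := Cantor.of_nat n in
      exists s : nat -> nat,
        [/\ run o f a (s 0),
            forall i, i < k -> run o g (npair a (npair i (s i))) (s i.+1)
          & r = s k]
  | Mu f =>
      run o f (npair n r) 0 /\
      forall k, k < r -> exists m, run o f (npair n k) m.+1
  end.

(* Absolute computability is computability relative to the zero sequence. *)
Definition no_oracle : nat -> bool := fun=> false.

Definition computable (f : nat -> nat) : Prop :=
  exists c, forall n, run no_oracle c n (f n).

Definition recursively_enumerable (E : set nat) : Prop :=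
  exists c, forall n, E n <-> exists r, run no_oracle c n r.

Definition decidable_set (E : set nat) : Prop :=
  computable (fun n => `[< E n >]).

(* [c], read as a Turing functional, is defined at [q] with value [p]. *)
Definition turing_functional (c : code) (q p : nat -> bool) : Prop :=
  forall n, run q c n (p n).

Definition medvedev_le (P Q : set (nat -> bool)) : Prop :=
  exists c, forall q, Q q -> exists2 p, P p & turing_functional c q p.

(* A degree is an equivalence class, as a set of subsets of {0,1}^nat. *)
Definition degree : Type := set (set (nat -> bool)).

Definition degree_of (P : set (nat -> bool)) : degree :=
  [set Q | medvedev_le P Q /\ medvedev_le Q P].

Definition degree_le (d e : degree) : Prop :=
  exists P Q, [/\ d P, e Q & medvedev_le P Q].

(* The complement of [P] is the union of the cylinders given by a recursively
   enumerable set [W] of finite binary words. *)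
Definition Pi01 (P : set (nat -> bool)) : Prop :=
  exists2 W : set (seq bool),
    recursively_enumerable
      [set CodeSeq.code (map nat_of_bool w) | w in W]
    & P = [set x | forall n, ~ W (mkseq x n)].

Definition Pi01_degrees : set degree :=
  [set degree_of P | P in [set P | Pi01 P /\ P !=set0]].

Definition is_maximal_Pi01_degree (d : degree) : Prop :=
  Pi01_degrees d /\ forall e, Pi01_degrees e -> degree_le e d.

(* The letter (i, false) is the i-th generator, (i, true) its inverse. *)
Definition letter (k : nat) : Type := ('I_k * bool)%type.

Definition reduced (k : nat) (w : seq (letter k)) : bool :=
  sorted (fun a b => ~~ ((a.1 == b.1) && (a.2 != b.2))) w.

(* The underlying set of the free group of rank [k]; its group law is not
   needed, only the evaluation of its elements. *)
Definition free_group (k : nat) : Type := {w : seq (letter k) | reduced w}.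

Definition word_code (k : nat) (w : seq (letter k)) : nat :=
  CodeSeq.code [seq (nat_of_ord l.1).*2 + l.2 | l : letter k <- w].

Definition word_eval (G : groupType) (k : nat) (s : 'I_k -> G)
    (w : seq (letter k)) : G :=
  (\prod_(l <- w) (if l.2 then (s l.1)^-1 else s l.1))%g.

(* A finite generating set S of [G], together with a computable bijection
   nat -> F(S).  As F(S) is then infinite, S is nonempty. *)
Record fin_gen (G : groupType) := FinGen {
  rank : nat;
  gen : 'I_rank -> G;
  gen_inj : injective gen;
  gen_surj : forall g : G, exists w, word_eval gen w = g;
  enum_free : nat -> free_group rank;
  enum_free_bij : bijective enum_free;
  enum_free_computable : computable (fun n => word_code (val (enum_free n)))
}.
Arguments gen {G} f.
Arguments enum_free {G} f.

Definition word_problem (G : groupType) (S : fin_gen G) : set nat :=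
  [set word_code w | w in [set w | word_eval (gen S) w = 1%g]].

Definition recursively_presented (G : groupType) (S : fin_gen G) : Prop :=
  recursively_enumerable (word_problem S).

Definition has_decidable_word_problem (G : groupType) (S : fin_gen G) : Prop :=
  decidable_set (word_problem S).

(* A^G with the prodiscrete topology. *)
Notation config G A := {ptws G -> discrete_topology A}.

Definition shift_config (G : groupType) (A : finType) (g : G) (x : config G A) :
  config G A := fun h => x (g^-1 * h)%g.

Definition is_subshift (G : groupType) (A : finType) (X : set (config G A)) :
    Prop :=
  closed X /\ forall g x, X x -> X (shift_config g x).

(* A pattern p in A^F is a finite map with domain F. *)
Definition cylinder (G : groupType) (A : finType) (p : {fmap G -> A}) :
    set (config G A) :=
  [set x | forall g, g \in domf p -> fnd p g = Some (x g)].

Definition is_SFT (G : groupType) (A : finType) (X : set (config G A)) : Prop :=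
  exists2 Fs : set {fmap G -> A}, finite_set Fs
    & X = [set x | forall g p, Fs p -> ~ cylinder p (shift_config g x)].

Definition is_sofic (G : groupType) (A : finType) (X : set (config G A)) :
    Prop :=
  is_subshift X /\
  exists (B : finType) (Y : set (config G B)) (phi : config G B -> config G A),
    [/\ is_SFT Y, {within Y, continuous phi},
        forall g y, Y y -> phi (shift_config g y) = shift_config g (phi y)
      & X = phi @` Y].

Definition pullback (T U : Type) (A : finType) (rho : T -> U)
    (X : set (config U A)) : set (config T A) :=
  [set (fun t => x (rho t)) | x in X].

Definition free_pullback (G : groupType) (S : fin_gen G) (A : finType)
    (X : set (config G A)) : set (config (free_group (rank S)) A) :=
  pullback (fun w => word_eval (gen S) (val w)) X.

(* Each letter of [A] is written as a block of #|A| bits, the a-th of which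
   is 1 exactly for the a-th letter; the n-th block codes the letter at the
   n-th element of F(S). *)
Definition binary_coding (G : groupType) (S : fin_gen G) (A : finType)
    (x : config (free_group (rank S)) A) : nat -> bool :=
  fun n => nat_of_ord (enum_rank (x (enum_free S (n %/ #|A|)) : A))
           == n %% #|A|.

Definition coded (G : groupType) (S : fin_gen G) (A : finType)
    (X : set (config G A)) : set (nat -> bool) :=
  @binary_coding G S A @` free_pullback X.

Definition is_effective (G : groupType) (S : fin_gen G) (A : finType)
    (X : set (config G A)) : Prop :=
  is_subshift X /\ Pi01 (coded S X).

Definition subshift_degree (G : groupType) (S : fin_gen G) (A : finType)
    (X : set (config G A)) : degree :=
  degree_of (coded S X).

Definition M_SFT (G : groupType) (S : fin_gen G) : set degree :=
  [set d | exists (A : finType) (X : set (config G A)),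
     [/\ X !=set0, is_SFT X & d = subshift_degree S X]].

Definition M_SOF (G : groupType) (S : fin_gen G) : set degree :=
  [set d | exists (A : finType) (X : set (config G A)),
     [/\ X !=set0, is_sofic X & d = subshift_degree S X]].

Definition M_EFF (G : groupType) (S : fin_gen G) : set degree :=
  [set d | exists (A : finType) (X : set (config G A)),
     [/\ X !=set0, is_effective S X & d = subshift_degree S X]].

Definition simulates (G H : groupType) (SH : fin_gen H) : Prop :=
  exists2 rho : {multiplicative G -> H},
    forall h, exists g, rho g = h
    & forall (A : finType) (X : set (config H A)),
        is_effective SH X -> is_sofic (pullback rho X).
Arguments simulates G {H} SH.

(* Main.v *)
Require Import Defs.
From mathcomp Require Import all_boot finmap.
From mathcomp Require Import boolp classical_sets cardinality topology.
From mathcomp Require Import zify.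

Set Implicit Arguments.
Unset Strict Implicit.
Unset Printing Implicit Defensive.

(* The key construction is a subshift X_P on H attached to a closed set P.  Its
   alphabet carries a pointer (a generator, or nothing) and two bits.  Following
   pointers from a point spells a sequence of labels; X_P consists of the
   configurations such that, from every point, decoding these labels yields an
   element of P.  Given p in P, let every h other than 1 point to a neighbour
   closer to 1, with labels (v(d) mod 2, p(v(d))) for d = |h| and v the 2-adic
   valuation.  Along a path d decreases by 1, and finitely many parities of
   v(d - i) suffice to recognise the d divisible by exactly 2^n, which then show
   p(n); as H is infinite such a d occurs in every ball of radius 10 * 2^n, even
   though the identity interrupts some paths.  So X_P is nonempty, its points
   compute elements of P, and p computes a point of X_P if the word problem is
   decidable.  For (2), P is the class of 0-1 functions separating the programs
   with output 0 from those with output 1; the SFT is a cover of the pullback of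
   X_P, and the factor map is computable by the Curtis-Hedlund-Lyndon theorem. *)

(** * Recursive functionals *)

(** The group may have no element of infinite order, so a sequence cannot simply be laid along the
    cosets of an infinite cyclic subgroup; descending paths to the identity take the place of such
    cosets. Shift invariance imposes the decoding condition at every base point, so every bit of p
    has to recur at bounded distance from everywhere. Valuations recur in this way, but they are
    unbounded, and a finite alphabet can only show them modulo 2. The constants fit together: the
    test at level n looks up to 3 * 2^n steps ahead, 5 is the least odd number above 3, and a point
    of length less than 5 * 2^n lies within 10 * 2^n of any point of length 5 * 2^n. In (2) the word
    problem is only enumerable. Inconsistent letters can still be detected, so X_P is effective, but
    p need not compute word lengths. For the maximal degree this does no harm: it is enough that X_P
    is nonempty and that its points compute elements of P. The relation [run] counts no steps and
    records no oracle use, while stages of enumerations and the separating class need both. An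
    abstract machine, proved equivalent to [run], supplies them. *)

Lemma of_npair a b : Cantor.of_nat (npair a b) = (a, b).
Proof. exact: Cantor.cancel_of_to. Qed.

Definition nfst n := (Cantor.of_nat n).1.
Definition nsnd n := (Cantor.of_nat n).2.

Lemma nfst_pair a b : nfst (npair a b) = a.
Proof. by rewrite /nfst of_npair. Qed.

Lemma nsnd_pair a b : nsnd (npair a b) = b.
Proof. by rewrite /nsnd of_npair. Qed.

Lemma npairK n : npair (nfst n) (nsnd n) = n.
Proof. by rewrite /npair -surjective_pairing Cantor.cancel_to_of. Qed.

(** Programs act on single numbers. One encoding attached to each type lets computability be stated
    for functions on lists, words and letters, and be proved by composition. *)
Class Enc (A : Type) := enc : A -> nat.

#[export] Instance enc_nat : Enc nat := id.
#[export] Instance enc_bool : Enc bool := nat_of_bool.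
#[export] Instance enc_prod A B (eA : Enc A) (eB : Enc B) : Enc (A * B) :=
  fun p => npair (enc p.1) (enc p.2).
#[export] Instance enc_seq A (eA : Enc A) : Enc (seq A) :=
  fun s => CodeSeq.code (map enc s).

(** The first argument of [f] is the oracle, and one program serves all oracles: these are
    everywhere defined Turing functionals, the form in which reductions are built below. *)
Definition recursive A B (eA : Enc A) (eB : Enc B) (f : (nat -> bool) -> A -> B) :=
  exists c, forall o a, run o c (enc a) (enc (f o a)).
Arguments recursive {A B eA eB} f.

Section Basic.
Context {A B C : Type} {eA : Enc A} {eB : Enc B} {eC : Enc C}.

Lemma rec_eq (f g : (nat -> bool) -> A -> B) :
  (forall o a, f o a = g o a) -> recursive f -> recursive g.
Proof. by move=> e [c cP]; exists c => o a; rewrite -e. Qed.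

Lemma rec_raw (f : (nat -> bool) -> A -> B) :
  recursive f -> recursive (fun o a => enc (f o a)).
Proof. by case=> c cP; exists c. Qed.

Lemma rec_unraw (f : (nat -> bool) -> A -> B) :
  recursive (fun o a => enc (f o a)) -> recursive f.
Proof. by case=> c cP; exists c. Qed.

(** There is no identity program among the constructors of [code]; pairing the two projections
    rebuilds the input. *)
Lemma rec_id : recursive (fun _ (a : A) => a).
Proof.
by exists (Pair Left Right) => o a /=; exists (nfst (enc a)), (nsnd (enc a)); rewrite npairK.
Qed.

Lemma rec_comp (F : (nat -> bool) -> B -> C) (f : (nat -> bool) -> A -> B) :
  recursive F -> recursive f -> recursive (fun o a => F o (f o a)).
Proof.
by case=> c cP [d dP]; exists (Comp c d) => o a; exists (enc (f o a)).
Qed.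

Lemma rec_pair (f : (nat -> bool) -> A -> B) (g : (nat -> bool) -> A -> C) :
  recursive f -> recursive g -> recursive (fun o a => (f o a, g o a)).
Proof.
case=> c cP [d dP]; exists (Pair c d) => o a.
by exists (enc (f o a)), (enc (g o a)).
Qed.

Lemma rec_fst (f : (nat -> bool) -> A -> B * C) :
  recursive f -> recursive (fun o a => (f o a).1).
Proof.
case=> c cP; exists (Comp Left c) => o a; exists (enc (f o a)) => //=.
by rewrite of_npair.
Qed.

Lemma rec_snd (f : (nat -> bool) -> A -> B * C) :
  recursive f -> recursive (fun o a => (f o a).2).
Proof.
case=> c cP; exists (Comp Right c) => o a; exists (enc (f o a)) => //=.
by rewrite of_npair.
Qed.

Lemma rec_cst (b : B) : recursive (fun _ (_ : A) => b).
Proof.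
suff [c cP] : exists c, forall o n, run o c n (@enc _ eB b) by exists c => o a.
move: (@enc _ eB b) => m; elim: m => [|m [c cP]]; first by exists Zero.
by exists (Comp Succ c) => o n /=; exists m.
Qed.

Lemma rec_S (f : (nat -> bool) -> A -> nat) :
  recursive f -> recursive (fun o a => (f o a).+1).
Proof. by case=> c cP; exists (Comp Succ c) => o a; exists (f o a) => //; apply: cP. Qed.

Lemma rec_oracle (f : (nat -> bool) -> A -> nat) :
  recursive f -> recursive (fun o a => o (f o a)).
Proof. by case=> c cP; exists (Comp Oracle c) => o a; exists (f o a) => //; apply: cP. Qed.

End Basic.

Lemma rec_comp2 A B C D (eA : Enc A) (eB : Enc B) (eC : Enc C) (eD : Enc D)
  (F : (nat -> bool) -> A -> B -> C) (f : (nat -> bool) -> D -> A) (g : (nat -> bool) -> D -> B) :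
  recursive (fun o p => F o p.1 p.2) -> recursive f -> recursive g ->
  recursive (fun o x => F o (f o x) (g o x)).
Proof.
move=> rF rf rg.
exact: (rec_comp (F := fun o p => F o p.1 p.2) rF (rec_pair rf rg)).
Qed.

(** The step of [PrimRec] receives the parameter, the index and the previous value, exactly as in
    [iteri]; bounded loops below reduce to this case. *)
Lemma rec_iteri A B (eA : Enc A) (eB : Enc B) (k : (nat -> bool) -> A -> nat)
  (g : (nat -> bool) -> A -> nat -> B -> B) (z : (nat -> bool) -> A -> B) :
  recursive k -> recursive (fun o (p : A * (nat * B)) => g o p.1 p.2.1 p.2.2) ->
  recursive z -> recursive (fun o a => iteri (k o a) (g o a) (z o a)).
Proof.
case=> ck kP [cg gP] [cz zP].
exists (Comp (PrimRec cz cg) (Pair (Pair Left Right) ck)) => o a.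
exists (npair (enc a) (k o a)).
  exists (enc a), (k o a); split; [|exact: (kP o a)|by []].
  by exists (nfst (enc a)), (nsnd (enc a)); rewrite npairK.
rewrite /= of_npair; exists (fun i => enc (iteri i (g o a) (z o a))); split=> //.
by move=> i _; apply: (gP o (a, (i, _))).
Qed.

Lemma rec_iter A B (eA : Enc A) (eB : Enc B) (k : (nat -> bool) -> A -> nat)
  (g : (nat -> bool) -> A -> B -> B) (z : (nat -> bool) -> A -> B) :
  recursive k -> recursive (fun o (p : A * B) => g o p.1 p.2) ->
  recursive z -> recursive (fun o a => iter (k o a) (g o a) (z o a)).
Proof.
move=> rk rg rz.
have rg' : recursive (fun o (p : A * (nat * B)) => g o p.1 p.2.2).
  apply: (rec_comp2 (F := g)) => //; first exact/rec_fst/rec_id.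
  exact/rec_snd/rec_snd/rec_id.
apply: rec_eq (rec_iteri (g := fun o a _ => g o a) rk rg' rz) => o a.
by elim: (k o a) => //= n ->.
Qed.

(** Branching is a primitive recursion whose step ignores the previous value: no round leaves [f],
    any positive number of rounds leaves [g]. *)
Lemma rec_ifn A B (eA : Enc A) (eB : Enc B) (t : (nat -> bool) -> A -> nat)
  (f g : (nat -> bool) -> A -> B) :
  recursive t -> recursive f -> recursive g ->
  recursive (fun o a => if t o a is 0 then f o a else g o a).
Proof.
move=> rt rf rg.
have rg' : recursive (fun o (p : A * (nat * B)) => g o p.1).
  exact: (rec_comp (F := g) rg (rec_fst (rec_id))).
apply: rec_eq (rec_iteri (g := fun o a _ _ => g o a) rt rg' rf) => o a.
by case: (t o a).
Qed.

Lemma rec_if A B (eA : Enc A) (eB : Enc B) (t : (nat -> bool) -> A -> bool)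
  (f g : (nat -> bool) -> A -> B) :
  recursive t -> recursive f -> recursive g ->
  recursive (fun o a => if t o a then f o a else g o a).
Proof.
move=> rt rf rg; apply: rec_eq (rec_ifn (rec_raw rt) rg rf) => o a.
by case: (t o a).
Qed.

Lemma rec_andb A (eA : Enc A) (s t : (nat -> bool) -> A -> bool) :
  recursive s -> recursive t -> recursive (fun o a => s o a && t o a).
Proof. by move=> rs rt; apply: (rec_if rs rt (rec_cst false)). Qed.

Lemma rec_orb A (eA : Enc A) (s t : (nat -> bool) -> A -> bool) :
  recursive s -> recursive t -> recursive (fun o a => s o a || t o a).
Proof. by move=> rs rt; apply: (rec_if rs (rec_cst true) rt). Qed.

Lemma rec_negb A (eA : Enc A) (s : (nat -> bool) -> A -> bool) :
  recursive s -> recursive (fun o a => ~~ s o a).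
Proof. by move=> rs; apply: (rec_if rs (rec_cst false) (rec_cst true)). Qed.

Lemma rec_implyb A (eA : Enc A) (s t : (nat -> bool) -> A -> bool) :
  recursive s -> recursive t -> recursive (fun o a => s o a ==> t o a).
Proof. by move=> rs rt; apply: (rec_if rs rt (rec_cst true)). Qed.

Ltac rec_user := fail.

Ltac rec_step :=
  match goal with
  | H : recursive _ |- _ => exact H
  | |- recursive (fun o a => a) => exact rec_id
  | |- recursive (fun o a => ?b) => exact (rec_cst b)
  | |- recursive (fun o a => (@?f o a, @?g o a)) => refine (rec_pair (f := f) (g := g) _ _)
  | |- recursive (fun o a => S (@?f o a)) => refine (rec_S (f := f) _)
  | |- recursive (fun o a => if _ then _ else _) => refine (rec_if _ _ _)
  | |- recursive (fun o a => andb (@?s o a) (@?t o a)) => refine (rec_andb (s := s) (t := t) _ _)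
  | |- recursive (fun o a => orb (@?s o a) (@?t o a)) => refine (rec_orb (s := s) (t := t) _ _)
  | |- recursive (fun o a => implb (@?s o a) (@?t o a)) =>
      refine (rec_implyb (s := s) (t := t) _ _)
  | |- recursive (fun o a => negb (@?s o a)) => refine (rec_negb (s := s) _)
  | |- recursive (fun o a => o (@?f o a)) => refine (rec_oracle (f := f) _)
  | |- _ => rec_user
  | |- recursive (fun o a => fst (@?f o a)) => refine (rec_fst (f := f) _)
  | |- recursive (fun o a => snd (@?f o a)) => refine (rec_snd (f := f) _)
  end.

Ltac rec := repeat rec_step.

(** * Arithmetic, determinism of programs, minimisation and bounded search *)

Section Arith.
Context {A : Type} {eA : Enc A}.
Implicit Types f g : (nat -> bool) -> A -> nat.

Lemma rec_add f g : recursive f -> recursive g -> recursive (fun o a => f o a + g o a).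
Proof.
move=> rf rg; have rs : recursive (fun o (p : A * nat) => p.2.+1) by rec.
by apply: rec_eq (rec_iter (g := fun _ _ => S) rf rs rg) => o a; rewrite iter_succn addnC.
Qed.

Lemma rec_pred f : recursive f -> recursive (fun o a => (f o a).-1).
Proof.
move=> rf; have rs : recursive (fun o (p : A * (nat * nat)) => p.2.1) by rec.
apply: rec_eq (rec_iteri (g := fun _ _ i _ => i) rf rs (rec_cst 0)) => o a.
by case: (f o a).
Qed.

End Arith.

Section Arith2.
Context {A : Type} {eA : Enc A}.
Implicit Types f g : (nat -> bool) -> A -> nat.

Lemma rec_sub f g : recursive f -> recursive g -> recursive (fun o a => f o a - g o a).
Proof.
move=> rf rg; have rs : recursive (fun o (p : A * nat) => p.2.-1).
  by apply: rec_pred; rec.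
by apply: rec_eq (rec_iter (g := fun _ _ => predn) rg rs rf) => o a; rewrite iter_predn.
Qed.

Lemma rec_mul f g : recursive f -> recursive g -> recursive (fun o a => f o a * g o a).
Proof.
move=> rf rg; have rs : recursive (fun o (p : A * nat) => g o p.1 + p.2).
  by apply: rec_add; rec; apply: (rec_comp (F := g)); rec.
apply: rec_eq (rec_iter (g := fun o a => addn (g o a)) rf rs (rec_cst 0)) => o a.
by rewrite iter_addn_0 mulnC.
Qed.

Lemma rec_leq f g : recursive f -> recursive g -> recursive (fun o a => f o a <= g o a).
Proof.
move=> rf rg.
apply: rec_eq (rec_ifn (rec_sub rf rg) (rec_cst true) (rec_cst false)) => o a.
by rewrite -subn_eq0; case: (_ - _).
Qed.

Lemma rec_eqn f g : recursive f -> recursive g -> recursive (fun o a => f o a == g o a).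
Proof.
move=> rf rg; apply: rec_eq (rec_andb (rec_leq rf rg) (rec_leq rg rf)) => o a.
by rewrite eqn_leq.
Qed.

End Arith2.

Section Arith3.
Context {A : Type} {eA : Enc A}.
Implicit Types f g : (nat -> bool) -> A -> nat.

Lemma rec_exp f g : recursive f -> recursive g -> recursive (fun o a => f o a ^ g o a).
Proof.
move=> rf rg; have rs : recursive (fun o (p : A * nat) => f o p.1 * p.2).
  by apply: rec_mul; rec; apply: (rec_comp (F := f)); rec.
apply: rec_eq (rec_iter (g := fun o a => muln (f o a)) rg rs (rec_cst 1)) => o a.
by elim: (g o a) => //= n ->; rewrite expnS.
Qed.

Lemma rec_odd f : recursive f -> recursive (fun o a => odd (f o a)).
Proof.
move=> rf; have rs : recursive (fun o (p : A * bool) => ~~ p.2) by rec.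
apply: rec_eq (rec_iter (g := fun o a => negb) rf rs (rec_cst false)) => o a.
by elim: (f o a) => //= n ->.
Qed.

End Arith3.

Ltac rec_arith :=
  match goal with
  | |- recursive (fun o a => addn (@?f o a) (@?g o a)) => refine (rec_add (f := f) (g := g) _ _)
  | |- recursive (fun o a => subn (@?f o a) (@?g o a)) => refine (rec_sub (f := f) (g := g) _ _)
  | |- recursive (fun o a => muln (@?f o a) (@?g o a)) => refine (rec_mul (f := f) (g := g) _ _)
  | |- recursive (fun o a => leq (@?f o a) (@?g o a)) => refine (rec_leq (f := f) (g := g) _ _)
  | |- recursive (fun o a => eq_op (@?f o a) (@?g o a)) =>
      refine (rec_eqn (f := f) (g := g) _ _)
  | |- recursive (fun o a => expn (@?f o a) (@?g o a)) => refine (rec_exp (f := f) (g := g) _ _)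
  | |- recursive (fun o a => odd (@?f o a)) => refine (rec_odd (f := f) _)
  | |- recursive (fun o a => predn (@?f o a)) => refine (rec_pred (f := f) _)
  end.
Ltac rec_user ::= rec_arith.

(** For [PrimRec] the two traces agree by induction. For [Mu], of two distinct outputs the larger
    would demand a nonzero value at the smaller, where the value is 0. *)
Lemma run_inj o c n r r' : run o c n r -> run o c n r' -> r = r'.
Proof.
elim: c n r r' => //=.
- by move=> n r r' -> ->.
- by move=> n r r' -> ->.
- by move=> n r r' -> ->.
- by move=> n r r' -> ->.
- by move=> n r r' -> ->.
- move=> f IHf g IHg n r r' [a [b [fa gb ->]]] [a' [b' [fa' gb' ->]]].
  by rewrite (IHf _ _ _ fa fa') (IHg _ _ _ gb gb').
- by move=> f IHf g IHg n r r' [m gm fr] [m' gm' fr']; rewrite (IHg _ _ _ gm gm') in fr;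
  apply: IHf fr fr'.
- move=> f IHf g IHg n r r'; case: (Cantor.of_nat n) => a k [s [s0 si ->]] [t [t0 ti ->]].
  suff : forall i, i <= k -> s i = t i by apply.
  elim=> [|i IH] ik; first exact: IHf s0 t0.
  by apply: IHg (si _ ik) _; rewrite IH 1?ltnW //; apply: ti.
- move=> f IHf n r r' [fr fk] [fr' fk']; apply/eqP; rewrite eqn_leq; apply/andP; split.
    by rewrite leqNgt; apply/negP => /fk[m /IHf /(_ fr')].
  by rewrite leqNgt; apply/negP => /fk'[m /IHf /(_ fr)].
Qed.

(** [Mu] looks for a zero, hence the negation of the test. The equivalence also covers inputs
    without a witness, where the program diverges; semi-decision procedures rely on this. *)
Lemma mu_code A (eA : Enc A) (g : (nat -> bool) -> A -> nat -> bool) :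
  recursive (fun o (p : A * nat) => g o p.1 p.2) ->
  exists c, forall o a k,
    run o c (enc a) k <-> g o a k /\ forall j, j < k -> ~~ g o a j.
Proof.
move=> rg; have : recursive (fun o (p : A * nat) => ~~ g o p.1 p.2) by rec.
case=> c cP; exists (Mu c) => o a k; split=> -[gk gj]; split.
- by move: (run_inj gk (cP o (a, k))) => /=; case: (g o a k).
- move=> j /gj[m cm]; by move: (run_inj cm (cP o (a, j))) => /=; case: (g o a j).
- by have := cP o (a, k); rewrite /= gk.
- by move=> j /gj ngj; exists 0; have := cP o (a, j); rewrite /= ngj.
Qed.

Lemma rec_mu A (eA : Enc A) (g : (nat -> bool) -> A -> nat -> bool)
  (ex : forall o a, exists k, g o a k) :
  recursive (fun o (p : A * nat) => g o p.1 p.2) ->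
  recursive (fun o a => ex_minn (ex o a)).
Proof.
move=> /mu_code[c cP]; exists c => o a; case: ex_minnP => k gk kmin.
by apply/cP; split=> // j jk; apply/negP => /kmin; rewrite leqNgt jk.
Qed.

Section Search.
Context {A : Type} {eA : Enc A}.

Lemma rec_find_iota (k : (nat -> bool) -> A -> nat) (g : (nat -> bool) -> A -> nat -> bool) :
  recursive k -> recursive (fun o (p : A * nat) => g o p.1 p.2) ->
  recursive (fun o a => find (g o a) (iota 0 (k o a))).
Proof.
move=> rk rg.
(* After the indices below i have been treated, an accumulator below i is the first witness;
   otherwise it equals i and nothing has been found yet. *)
have rs : recursive (fun o (p : A * (nat * nat)) =>
    if p.2.2 < p.2.1 then p.2.2 else if g o p.1 p.2.1 then p.2.1 else p.2.1.+1).
  by rec; apply: (rec_comp2 (F := g)); rec.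
apply: rec_eq (rec_iteri (g := fun o a i r => if r < i then r else if g o a i then i else i.+1)
  rk rs (rec_cst 0)) => o a.
elim: (k o a) => // n IH; rewrite -addn1 iotaD find_cat size_iota add0n addn1 /= IH has_find
  size_iota.
case: ltnP => // nf; case: (g o a n); rewrite ?addn0 ?addn1 //.
Qed.

End Search.

Section Division.
Context {A : Type} {eA : Enc A}.
Implicit Types f g : (nat -> bool) -> A -> nat.

(** The quotient is the least q with [f < q.+1 * g], sought up to f. Divisor 0 is treated apart,
    since the search would then fail instead of returning 0. *)
Lemma rec_divn f g : recursive f -> recursive g -> recursive (fun o a => f o a %/ g o a).
Proof.
move=> rf rg.
have rt : recursive (fun o (p : A * nat) => f o p.1 < p.2.+1 * g o p.1).
  by rec; [apply: (rec_comp (F := f))|apply: (rec_comp (F := g))]; rec.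
have rk : recursive (fun o a => (f o a).+1) by rec.
have rh := rec_find_iota (g := fun o a q => f o a < q.+1 * g o a) rk rt.
apply: rec_eq (rec_ifn rg (rec_cst 0) rh) => o a.
case: (posnP (g o a)) => [->|g0]; first by rewrite divn0.
case E: (g o a) g0 => [//|d] _; rewrite -E.
have d0 : 0 < g o a by rewrite E.
set P := fun q => _; set n := (f o a).+1.
have Pq : P (f o a %/ g o a) by rewrite /P -ltn_divLR ?ltnS.
have qn : f o a %/ g o a < n by rewrite ltnS leq_div.
have hs : has P (iota 0 n) by apply/hasP; exists (f o a %/ g o a); rewrite // mem_iota.
have fn : find P (iota 0 n) < n by rewrite -[X in _ < X](size_iota 0) -has_find.
apply/eqP; rewrite eqn_leq; apply/andP; split.
  by rewrite leqNgt; apply/negP => /(before_find 0); rewrite nth_iota // add0n Pq.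
have := nth_find 0 hs; rewrite nth_iota // add0n /P.
by rewrite -ltn_divLR // ltnS.
Qed.

End Division.

Section Division2.
Context {A : Type} {eA : Enc A}.
Implicit Types f g : (nat -> bool) -> A -> nat.

Lemma rec_modn f g : recursive f -> recursive g -> recursive (fun o a => f o a %% g o a).
Proof.
move=> rf rg; have : recursive (fun o a => f o a - f o a %/ g o a * g o a).
  by rec; apply: rec_divn.
by apply: rec_eq => o a; rewrite {1}(divn_eq (f o a) (g o a)) addKn.
Qed.

End Division2.

Section Division3.
Context {A : Type} {eA : Enc A}.
Implicit Types f g : (nat -> bool) -> A -> nat.

Lemma logn2_find n : logn 2 n = find (fun k => n %% 2 ^ k.+1 != 0) (iota 0 n).
Proof.
case: (posnP n) => [->|n0]; first by [].
have lt : logn 2 n < n.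
  by rewrite (leq_trans (ltn_expl (logn 2 n) (isT : 1 < 2))) // dvdn_leq // pfactor_dvdnn.
rewrite -[X in iota 0 X](subnKC (ltnW lt)) iotaD find_cat ifF; last first.
  apply/hasPn => i; rewrite mem_iota add0n => /andP[_ il] /=.
  by rewrite negbK -/(dvdn _ _) pfactor_dvdn.
rewrite size_iota add0n; case E : (n - _) => [|m]; first by lia.
by rewrite /= ifT ?addn0 // -/(dvdn _ _) pfactor_dvdn // ltnn.
Qed.

Lemma rec_logn2 f : recursive f -> recursive (fun o a => logn 2 (f o a)).
Proof.
move=> rf.
have rt : recursive (fun o (p : nat * nat) => p.1 %% 2 ^ p.2.+1 != 0).
  by rec; apply: rec_modn; rec.
have := rec_find_iota (g := fun o n k => n %% 2 ^ k.+1 != 0) rec_id rt.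
move=> rl; apply: rec_eq (rec_comp rl rf) => o a.
by rewrite logn2_find.
Qed.

End Division3.

(** [CodeSeq.code (a :: s)] is 2^a times the odd number [(CodeSeq.code s).*2.+1]. So the head is a
    2-adic valuation and the tail is half of the odd part, rounded down: taking lists apart becomes
    arithmetic. *)
Lemma logn2_code a s : logn 2 (CodeSeq.code (a :: s)) = a.
Proof.
rewrite /= lognM ?expn_gt0 //; rewrite pfactorK // lognE /= dvdn2 /= odd_double /= addn0 //.
Qed.

Lemma tail_code a s :
  CodeSeq.code (a :: s) %/ 2 ^ (logn 2 (CodeSeq.code (a :: s))).+1 = CodeSeq.code s.
Proof.
rewrite logn2_code /= expnS mulnC divnMr ?expn_gt0 //.
by rewrite -addn1 -muln2 divnMDl // addn0.
Qed.

Ltac rec_division :=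
  match goal with
  | |- recursive (fun o a => divn (@?f o a) (@?g o a)) => refine (rec_divn (f := f) (g := g) _ _)
  | |- recursive (fun o a => modn (@?f o a) (@?g o a)) => refine (rec_modn (f := f) (g := g) _ _)
  | |- recursive (fun o a => logn 2 (@?f o a)) => refine (rec_logn2 (f := f) _)
  end.
Ltac rec_user ::= first [rec_arith | rec_division].

(** * Recursion on coded lists *)

Section Lists.
Context {A T B : Type} {eA : Enc A} {eT : Enc T} {eB : Enc B}.

Lemma rec_cons (f : (nat -> bool) -> A -> T) (l : (nat -> bool) -> A -> seq T) :
  recursive f -> recursive l -> recursive (fun o a => f o a :: l o a).
Proof.
move=> rf rl; apply: rec_unraw.
have : recursive (fun o a => 2 ^ @enc _ eT (f o a) * (@enc _ (enc_seq eT) (l o a) * 2).+1).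
  by have := rec_raw rf; have := rec_raw rl; move=> r1 r2; rec.
by apply: rec_eq => o a; rewrite muln2.
Qed.

(** No decoding from numbers back to [T] is available, so the branch is assembled from programs: a
    primitive recursion with 0 or 1 rounds, according to whether the code of the list is 0, whose
    step feeds the codes of head and tail to the program of [g]. *)
Lemma rec_case_seq (l : (nat -> bool) -> A -> seq T) (f : (nat -> bool) -> A -> B)
  (g : (nat -> bool) -> A -> T -> seq T -> B) :
  recursive l -> recursive f ->
  recursive (fun o (p : A * (T * seq T)) => g o p.1 p.2.1 p.2.2) ->
  recursive (fun o a => if l o a is x :: s then g o a x s else f o a).
Proof.
move=> rl [cf fP] [cg gP].
have rm : recursive (fun o a => @enc _ (enc_seq eT) (l o a)) by exact: rec_raw.
have [ck kP] : recursive (fun o a => (@enc _ (enc_seq eT) (l o a) != 0 : bool)) by rec.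
have [cx xP] : recursive (fun o a => logn 2 (@enc _ (enc_seq eT) (l o a))) by rec.
have [cs sP] : recursive (fun o a => @enc _ (enc_seq eT) (l o a)
                           %/ 2 ^ (logn 2 (@enc _ (enc_seq eT) (l o a))).+1) by rec.
have [ci iP] : recursive (fun _ (a : nat) => a) by exact: rec_id.
exists (Comp (PrimRec cf (Comp cg (Comp (Pair ci (Pair cx cs)) Left))) (Pair ci ck)) => o a.
have key h := h o a.
exists (npair (@enc _ eA a) ((@enc _ (enc_seq eT) (l o a) != 0 : bool) : nat)).
  exists (@enc _ eA a), ((@enc _ (enc_seq eT) (l o a) != 0 : bool) : nat).
  by split; [exact: (iP o (@enc _ eA a))|exact: kP|].
rewrite /= of_npair.
move: (xP o a) (sP o a); case: (l o a) => [|x s] xa sa.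
  by exists (fun _ => enc (f o a)); split => //; apply: fP.
rewrite /enc /enc_seq /= in xa sa *.
exists (fun i => if i is 0 then enc (f o a) else enc (g o a x s)); split.
- exact: fP.
- move=> i; set b := (_ != 0 :> nat); have -> : b = true by rewrite /b muln_eq0 expn_eq0.
  case: i => // _.
  exists (npair (enc a) (npair (enc x) (@enc _ (enc_seq eT) s))); last first.
    exact: (gP o (a, (x, s))).
  exists (enc a); first by rewrite /= of_npair.
  exists (enc a), (npair (enc x) (@enc _ (enc_seq eT) s)); split => //;
    first exact: (iP o (enc a)).
  exists (enc x), (@enc _ (enc_seq eT) s); split => //.
    by move: xa; rewrite -[_ * _]/(CodeSeq.code (enc x :: map enc s)) logn2_code.
  move: sa; rewrite -[_ * _]/(CodeSeq.code (enc x :: map enc s)).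
  by rewrite tail_code.
- by set b := (_ != 0 :> nat); have -> : b = true by rewrite /b muln_eq0 expn_eq0.
Qed.

End Lists.

Lemma size_code s : size s <= CodeSeq.code s.
Proof.
elim: s => //= n s IH; have : 0 < 2 ^ n by rewrite expn_gt0.
by move: (2 ^ n) (CodeSeq.code s) IH => p c; nia.
Qed.

Section Lists2.
Context {A T B : Type} {eA : Enc A} {eT : Enc T} {eB : Enc B}.

Lemma rec_foldl (g : (nat -> bool) -> A -> B -> T -> B) (z : (nat -> bool) -> A -> B)
  (l : (nat -> bool) -> A -> seq T) :
  recursive (fun o (p : A * (B * T)) => g o p.1 p.2.1 p.2.2) -> recursive z -> recursive l ->
  recursive (fun o a => foldl (g o a) (z o a) (l o a)).
Proof.
move=> rg rz rl.
(* One round pops one element and an empty list is a fixed point, so the code of the list, which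
   bounds its size, can serve as the number of rounds. *)
pose st o a (p : B * seq T) := if p.2 is x :: s then (g o a p.1 x, s) else p.
have rs : recursive (fun o (p : A * (B * seq T)) => st o p.1 p.2).
  apply: (@rec_case_seq _ _ _ _ _ _ (fun o (p : A * (B * seq T)) =>
    p.2.2) (fun o (p : A * (B * seq T)) => p.2)
     (fun o (p : A * (B * seq T)) x s => (g o p.1 p.2.1 x, s))); rec.
  apply: (rec_comp (F := fun o (p : A * (B * T)) => g o p.1 p.2.1 p.2.2)
    (f := fun o (p : (A * (B * seq T)) * (T * seq T)) => (p.1.1, (p.1.2.1, p.2.1)))) => //; rec.
have rk : recursive (fun o a => @enc _ (enc_seq eT) (l o a)) by exact: rec_raw.
have rz' : recursive (fun o a => (z o a, l o a)) by rec.
apply: rec_eq (rec_fst (rec_iter rk rs rz')) => o a.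
have : size (l o a) <= @enc _ (enc_seq eT) (l o a).
  by rewrite -(size_map enc) size_code.
move: (@enc _ _ _) => k; move: (z o a) (l o a); elim: k => [|k IH] y [|x s] //=.
  by move=> _; rewrite -iterS (@iter_fix _ k.+1).
by move=> sk; rewrite -iterS iterSr -IH.
Qed.

End Lists2.

Section Lists3.
Context {A T B : Type} {eA : Enc A} {eT : Enc T} {eB : Enc B}.

Lemma rec_rev (l : (nat -> bool) -> A -> seq T) :
  recursive l -> recursive (fun o a => rev (l o a)).
Proof.
move=> rl.
have rs : recursive (fun o (p : A * (seq T * T)) => p.2.2 :: p.2.1) by apply: rec_cons; rec.
apply: rec_eq (rec_foldl (g := fun _ _ s x => x :: s) rs (rec_cst [::]) rl) => o a.
by rewrite -[RHS]cats0 -[rev _ ++ _]/(_ ++ [::]) -catrevE; elim: (l o a) [::] => //= x s IH t;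
  rewrite IH.
Qed.

Lemma rec_foldr (g : (nat -> bool) -> A -> T -> B -> B) (z : (nat -> bool) -> A -> B)
  (l : (nat -> bool) -> A -> seq T) :
  recursive (fun o (p : A * (T * B)) => g o p.1 p.2.1 p.2.2) -> recursive z -> recursive l ->
  recursive (fun o a => foldr (g o a) (z o a) (l o a)).
Proof.
move=> rg rz rl.
have rg' : recursive (fun o (p : A * (B * T)) => g o p.1 p.2.2 p.2.1).
  apply: (rec_comp (F := fun o (p : A * (T * B)) => g o p.1 p.2.1 p.2.2)
    (f := fun o (p : A * (B * T)) => (p.1, (p.2.2, p.2.1)))); rec.
apply: rec_eq (rec_foldl (g := fun o a y x => g o a x y) rg' rz (rec_rev rl)) => o a.
by rewrite -(revK (l o a)) foldl_rev revK.
Qed.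

End Lists3.

Section Lists4.
Context {A T U : Type} {eA : Enc A} {eT : Enc T} {eU : Enc U}.
Implicit Types l : (nat -> bool) -> A -> seq T.

Lemma rec_cat l (s : (nat -> bool) -> A -> seq T) : recursive l -> recursive s ->
  recursive (fun o a => l o a ++ s o a).
Proof.
move=> rl rs.
have rc : recursive (fun o (p : A * (T * seq T)) => p.2.1 :: p.2.2) by apply: rec_cons; rec.
apply: rec_eq (rec_foldr (g := fun _ _ x t => x :: t) rc rs rl) => o a.
by elim: (l o a) => //= x t ->.
Qed.

End Lists4.

Section Lists5.
Context {A T U : Type} {eA : Enc A} {eT : Enc T} {eU : Enc U}.
Implicit Types l : (nat -> bool) -> A -> seq T.

Lemma rec_rcons l (f : (nat -> bool) -> A -> T) :
  recursive l -> recursive f -> recursive (fun o a => rcons (l o a) (f o a)).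
Proof.
move=> rl rf; have : recursive (fun o a => l o a ++ [:: f o a]).
  by apply: rec_cat => //; apply: rec_cons => //; rec.
by apply: rec_eq => o a; rewrite cats1.
Qed.

Lemma rec_map (g : (nat -> bool) -> A -> T -> U) l :
  recursive (fun o (p : A * T) => g o p.1 p.2) -> recursive l ->
  recursive (fun o a => map (g o a) (l o a)).
Proof.
move=> rg rl.
have rc : recursive (fun o (p : A * (T * seq U)) => g o p.1 p.2.1 :: p.2.2).
  by apply: rec_cons; rec; apply: (rec_comp2 (F := g)); rec.
apply: rec_eq (rec_foldr (g := fun o a x s => g o a x :: s) rc (rec_cst [::]) rl) => o a.
by elim: (l o a) => //= x t ->.
Qed.

Lemma rec_has (g : (nat -> bool) -> A -> T -> bool) l :
  recursive (fun o (p : A * T) => g o p.1 p.2) -> recursive l ->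
  recursive (fun o a => has (g o a) (l o a)).
Proof.
move=> rg rl.
have rc : recursive (fun o (p : A * (T * bool)) => g o p.1 p.2.1 || p.2.2).
  by rec; apply: (rec_comp2 (F := g)); rec.
apply: rec_eq (rec_foldr (g := fun o a x s => g o a x || s) rc (rec_cst false) rl) => o a.
by elim: (l o a) => //= x t ->.
Qed.

Lemma rec_all (g : (nat -> bool) -> A -> T -> bool) l :
  recursive (fun o (p : A * T) => g o p.1 p.2) -> recursive l ->
  recursive (fun o a => all (g o a) (l o a)).
Proof.
move=> rg rl.
have rc : recursive (fun o (p : A * (T * bool)) => g o p.1 p.2.1 && p.2.2).
  by rec; apply: (rec_comp2 (F := g)); rec.
apply: rec_eq (rec_foldr (g := fun o a x s => g o a x && s) rc (rec_cst true) rl) => o a.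
by elim: (l o a) => //= x t ->.
Qed.

Lemma rec_size l : recursive l -> recursive (fun o a => size (l o a)).
Proof.
move=> rl.
have rc : recursive (fun o (p : A * (T * nat)) => p.2.2.+1) by rec.
apply: rec_eq (rec_foldr (g := fun o a x s => s.+1) rc (rec_cst 0) rl) => o a.
by elim: (l o a) => //= x t ->.
Qed.

Lemma rec_drop (k : (nat -> bool) -> A -> nat) l :
  recursive k -> recursive l -> recursive (fun o a => drop (k o a) (l o a)).
Proof.
move=> rk rl.
have rb : recursive (fun o (p : A * seq T) => behead p.2).
  apply: rec_eq (@rec_case_seq _ _ _ _ _ _ (fun o (p : A * seq T) => p.2) (fun _ _ => [::])
    (fun _ _ _ s => s) _ _ _) => [o [a []]//|||]; rec.
apply: rec_eq (rec_iter (g := fun _ _ => behead) rk rb rl) => o a.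
by elim: (k o a) (l o a) => [|n IH] s; [rewrite drop0|rewrite iterSr IH; case: s => //=;
  case: n {IH}].
Qed.

Lemma rec_take (k : (nat -> bool) -> A -> nat) l :
  recursive k -> recursive l -> recursive (fun o a => take (k o a) (l o a)).
Proof.
move=> rk rl.
have : recursive (fun o a => rev (drop (size (rev (l o a)) - k o a) (rev (l o a)))).
  apply: rec_rev; apply: rec_drop; last exact: rec_rev.
  by apply: rec_sub => //; apply/rec_size/rec_rev.
by apply: rec_eq => o a; rewrite -take_rev revK.
Qed.

Lemma rec_nth (z : (nat -> bool) -> A -> T) l (k : (nat -> bool) -> A -> nat) :
  recursive z -> recursive l -> recursive k ->
  recursive (fun o a => nth (z o a) (l o a) (k o a)).
Proof.
move=> rz rl rk.
apply: rec_eq (@rec_case_seq _ _ _ _ _ _ (fun o a => drop (k o a) (l o a)) z (fun _ _ x _ =>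
  x) _ _ _); rec.
  move=> o a; case E : (drop _ _) => [|x s].
    by rewrite nth_default // -subn_eq0 -size_drop E.
  by rewrite -[k o a]addn0 -nth_drop E.
exact: rec_drop.
Qed.

End Lists5.

Section Lists6.
Context {A T : Type} {eA : Enc A} {eT : Enc T}.

Lemma rec_flatten (l : (nat -> bool) -> A -> seq (seq T)) :
  recursive l -> recursive (fun o a => flatten (l o a)).
Proof.
move=> rl.
have rc : recursive (fun o (p : A * (seq T * seq T)) => p.2.1 ++ p.2.2) by apply: rec_cat; rec.
apply: rec_eq (rec_foldr (g := fun o a x s => x ++ s) rc (rec_cst [::]) rl) => o a.
by elim: (l o a) => //= x t ->.
Qed.

End Lists6.

Lemma rec_iota A (eA : Enc A) (m k : (nat -> bool) -> A -> nat) :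
  recursive m -> recursive k -> recursive (fun o a => iota (m o a) (k o a)).
Proof.
move=> rm rk.
have rs : recursive (fun o (p : A * (nat * seq nat)) => rcons p.2.2 (m o p.1 + p.2.1)).
  by apply: rec_rcons; rec; apply: (rec_comp (F := m)); rec.
apply: rec_eq (rec_iteri (g := fun o a i s => rcons s (m o a + i)) rk rs (rec_cst [::])) => o a.
elim: (k o a) => // n IH; rewrite -[in RHS]addn1 iotaD cats1 -IH //.
Qed.

Lemma rec_mkseq A T (eA : Enc A) (eT : Enc T) (k : (nat -> bool) -> A -> nat)
  (g : (nat -> bool) -> A -> nat -> T) :
  recursive k -> recursive (fun o (p : A * nat) => g o p.1 p.2) ->
  recursive (fun o a => mkseq (g o a) (k o a)).
Proof. by move=> rk rg; apply: rec_map => //; apply: rec_iota => //; rec. Qed.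

Lemma rec_eqbool A (eA : Enc A) (s t : (nat -> bool) -> A -> bool) :
  recursive s -> recursive t -> recursive (fun o a => s o a == t o a).
Proof.
move=> rs rt; have : recursive (fun o a => if s o a then t o a else ~~ t o a) by rec.
by apply: rec_eq => o a; case: (s o a) (t o a) => [] [].
Qed.

Ltac rec_lists :=
  match goal with
  | |- recursive (fun o a => cons (@?f o a) (@?l o a)) => refine (rec_cons (f := f) (l := l) _ _)
  | |- recursive (fun o a => cat (@?f o a) (@?l o a)) => refine (rec_cat (l := f) (s := l) _ _)
  | |- recursive (fun o a => rcons (@?l o a) (@?f o a)) =>
    refine (rec_rcons (l := l) (f := f) _ _)
  | |- recursive (fun o a => rev (@?l o a)) => refine (rec_rev (l := l) _)
  | |- recursive (fun o a => size (@?l o a)) => refine (rec_size (l := l) _)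
  | |- recursive (fun o a => flatten (@?l o a)) => refine (rec_flatten (l := l) _)
  | |- recursive (fun o a => iota (@?m o a) (@?k o a)) => refine (rec_iota (m := m) (k := k) _ _)
  | |- recursive (fun o a => drop (@?k o a) (@?l o a)) => refine (rec_drop (k := k) (l := l) _ _)
  | |- recursive (fun o a => take (@?k o a) (@?l o a)) => refine (rec_take (k := k) (l := l) _ _)
  | |- recursive (fun o a => nth (@?z o a) (@?l o a) (@?k o a)) =>
      refine (rec_nth (z := z) (l := l) (k := k) _ _ _)
  | |- recursive (fun o a => has (@?g o a) (@?l o a)) =>
      refine (rec_has (g := g) (l := l) _ _); cbv beta
  | |- recursive (fun o a => all (@?g o a) (@?l o a)) =>
      refine (rec_all (g := g) (l := l) _ _); cbv beta
  | |- recursive (fun o a => map (@?g o a) (@?l o a)) =>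
      refine (rec_map (g := g) (l := l) _ _); cbv beta
  | |- recursive (fun o a => mkseq (@?g o a) (@?k o a)) =>
      refine (rec_mkseq (g := g) (k := k) _ _); cbv beta
  end.
Ltac rec_user ::= first [rec_arith | rec_division | rec_lists].

(** * Turing reductions and an abstract machine *)

Section PairNat.
Context {A : Type} {eA : Enc A}.
Implicit Types f g : (nat -> bool) -> A -> nat.

Lemma rec_nfst f : recursive f -> recursive (fun o a => nfst (f o a)).
Proof. by case=> c cP; exists (Comp Left c) => o a; exists (f o a); first exact: (cP o a). Qed.

Lemma rec_nsnd f : recursive f -> recursive (fun o a => nsnd (f o a)).
Proof. by case=> c cP; exists (Comp Right c) => o a; exists (f o a); first exact: (cP o a). Qed.

Lemma rec_npair f g : recursive f -> recursive g -> recursive (fun o a => npair (f o a) (g o a)).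
Proof. by move=> rf rg; have := rec_raw (rec_pair rf rg). Qed.

Lemma rec_nat_of_bool (s : (nat -> bool) -> A -> bool) :
  recursive s -> recursive (fun o a => nat_of_bool (s o a)).
Proof. exact: rec_raw. Qed.

End PairNat.

Ltac rec_pairs :=
  match goal with
  | |- recursive (fun o a => nfst (@?f o a)) => refine (rec_nfst (f := f) _)
  | |- recursive (fun o a => nsnd (@?f o a)) => refine (rec_nsnd (f := f) _)
  | |- recursive (fun o a => npair (@?f o a) (@?g o a)) =>
    refine (rec_npair (f := f) (g := g) _ _)
  | |- recursive (fun o a => eq_op (@?f o a) (@?g o a)) =>
      refine (rec_eqbool (s := f) (t := g) _ _)
  | |- recursive (fun o a => nat_of_bool (@?f o a)) => refine (rec_nat_of_bool (s := f) _)
  end.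
Ltac rec_user ::= first [rec_arith | rec_division | rec_lists | rec_pairs].

Fixpoint subst_oracle (d c : code) : code :=
  match c with
  | Oracle => d
  | Pair f g => Pair (subst_oracle d f) (subst_oracle d g)
  | Comp f g => Comp (subst_oracle d f) (subst_oracle d g)
  | PrimRec f g => PrimRec (subst_oracle d f) (subst_oracle d g)
  | Mu f => Mu (subst_oracle d f)
  | _ => c
  end.

Lemma run_subst_oracle (p q : nat -> bool) d c n r :
  (forall m, run q d m (p m : nat)) -> run p c n r -> run q (subst_oracle d c) n r.
Proof.
move=> dP; elim: c n r => //=.
- by move=> n r ->.
- by move=> f IHf g IHg n r [a [b [/IHf fa /IHg gb ->]]]; exists a, b.
- by move=> f IHf g IHg n r [m /IHg gm /IHf fr]; exists m.
- move=> f IHf g IHg n r; case: (Cantor.of_nat n) => a k [s [/IHf s0 si ->]].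
  by exists s; split=> // i /si /IHg.
- move=> f IHf n r [/IHf f0 fk]; split=> // k /fk[m /IHf fm]; by exists m.
Qed.

(** A program written for the zero oracle becomes independent of the oracle once its queries are
    answered by [Zero]. *)
Lemma rec_of_computable f : computable f -> recursive (fun _ n => f n).
Proof.
case=> c cP; exists (subst_oracle Zero c) => o n.
exact: (@run_subst_oracle no_oracle).
Qed.

Lemma medvedev_le_rec (P Q : set (nat -> bool)) Psi :
  recursive Psi -> (forall q, Q q -> P (Psi q)) -> medvedev_le P Q.
Proof. by case=> c cP QP; exists c => q Qq; exists (Psi q); [exact: QP|move=> n; apply: cP]. Qed.

Lemma medvedev_le_refl P : medvedev_le P P.
Proof. by apply: (@medvedev_le_rec _ _ (fun o n => o n))  => //; rec. Qed.

Lemma medvedev_le_trans P Q R : medvedev_le P Q -> medvedev_le Q R -> medvedev_le P R.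
Proof.
move=> [c cP] [d dP]; exists (subst_oracle d c) => r /dP[q /cP[p Pp pq] qr].
by exists p => // n; apply: run_subst_oracle (pq n).
Qed.

Lemma degree_of_eq P Q : medvedev_le P Q -> medvedev_le Q P -> degree_of P = degree_of Q.
Proof.
move=> PQ QP; apply/seteqP; split=> R [h1 h2]; split;
  by [apply: medvedev_le_trans h1|apply: medvedev_le_trans h2 _].
Qed.

(* A program is numbered by a stack frame <tag, data> of an abstract machine;
   tags 9 to 12 are the frames met while evaluating pairs, primitive
   recursions and minimisations. *)
Fixpoint code_num (c : code) : nat :=
  match c with
  | Zero => npair 0 0
  | Succ => npair 1 0
  | Left => npair 2 0
  | Right => npair 3 0
  | Oracle => npair 4 0
  | Pair f g => npair 5 (npair (code_num f) (code_num g))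
  | Comp f g => npair 6 (npair (code_num f) (code_num g))
  | PrimRec f g => npair 7 (npair (code_num f) (code_num g))
  | Mu f => npair 8 (code_num f)
  end.

Definition pair_frame g n := npair 9 (npair g n).
Definition pair_frame' a := npair 10 a.
Definition rec_frame g a i k := npair 11 (npair g (npair a (npair i k))).
Definition mu_frame f n r := npair 12 (npair f (npair n r)).

(* A state is the current value with the stack of pending frames; an oracle
   query beyond the known prefix [w] blocks. *)
Definition frame_step (w : seq bool) (v e : nat) (K : seq nat) : nat * seq nat :=
  let t := nfst e in let d := nsnd e in
  if t == 0 then (0, K) else
  if t == 1 then (v.+1, K) else
  if t == 2 then (nfst v, K) else
  if t == 3 then (nsnd v, K) else
  if t == 4 then
    (if v < size w then (nat_of_bool (nth false w v), K) else (v, e :: K)) else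
  if t == 5 then (v, nfst d :: pair_frame (nsnd d) v :: K) else
  if t == 6 then (v, nsnd d :: nfst d :: K) else
  if t == 7 then (nfst v, nfst d :: rec_frame (nsnd d) (nfst v) 0 (nsnd v) :: K) else
  if t == 8 then (npair v 0, d :: mu_frame d v 0 :: K) else
  if t == 9 then (nsnd d, nfst d :: pair_frame' v :: K) else
  if t == 10 then (npair d v, K) else
  if t == 11 then
    (if nfst (nsnd (nsnd d)) < nsnd (nsnd (nsnd d)) then
       (npair (nfst (nsnd d)) (npair (nfst (nsnd (nsnd d))) v),
        nfst d :: rec_frame (nfst d) (nfst (nsnd d)) (nfst (nsnd (nsnd d))).+1
                    (nsnd (nsnd (nsnd d))) :: K)
     else (v, K)) else
  if v == 0 then (nsnd (nsnd d), K)
  else (npair (nfst (nsnd d)) (nsnd (nsnd d)).+1,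
        nfst d :: mu_frame (nfst d) (nfst (nsnd d)) (nsnd (nsnd d)).+1 :: K).

Definition step (w : seq bool) (st : nat * seq nat) : nat * seq nat :=
  if st.2 is e :: K then frame_step w st.1 e K else st.

Lemma rec_step :
  recursive (fun _ (p : seq bool * (nat * seq nat)) => step p.1 p.2).
Proof.
apply: (@rec_case_seq _ _ _ _ _ _ (fun _ (p : seq bool * (nat * seq nat)) => p.2.2)
  (fun _ p => p.2) (fun _ p e K => frame_step p.1 p.2.1 e K)); rec.
rewrite /frame_step /pair_frame /pair_frame' /rec_frame /mu_frame; rec.
Qed.

Lemma step_halted w v s : iter s (step w) (v, [::]) = (v, [::]).
Proof. exact: iter_fix. Qed.

Lemma halted_leq w st v s s' : s <= s' ->
  iter s (step w) st = (v, [::]) -> iter s' (step w) st = (v, [::]).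
Proof. by move=> /subnK <- h; rewrite iterD h step_halted. Qed.

Definition frameE := (nfst_pair, nsnd_pair).

Ltac frame := rewrite /frame_step /pair_frame /pair_frame' /rec_frame /mu_frame /= ?frameE /=.

Ltac machine :=
  rewrite /step /frame_step /pair_frame /pair_frame' /rec_frame /mu_frame /= ?frameE /=.

(* [reaches q st st']: the number of steps does not depend on the known
   prefix of [q], as long as it is long enough. *)
Definition reaches (q : nat -> bool) (st st' : nat * seq nat) :=
  exists m s, forall k, m <= k -> iter s (step (mkseq q k)) st = st'.

Lemma reaches_trans q st1 st2 st3 :
  reaches q st1 st2 -> reaches q st2 st3 -> reaches q st1 st3.
Proof.
move=> [m [s h]] [m' [s' h']]; exists (maxn m m'), (s' + s) => k.
by rewrite geq_max => /andP[mk mk']; rewrite iterD h // h'.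
Qed.

Lemma reaches_step q st st' st'' :
  (forall k, step (mkseq q k) st = st') -> reaches q st' st'' -> reaches q st st''.
Proof. by move=> h; apply: reaches_trans; exists 0, 1 => k _ /=. Qed.

Lemma reaches_refl q st : reaches q st st.
Proof. by exists 0, 0. Qed.

(** The stack below the program is arbitrary, so that the runs of subprograms can be chained above
    the frames that wait for their results. *)
Lemma run_reaches q c n r K : run q c n r -> reaches q (n, code_num c :: K) (r, K).
Proof.
elim: c n r K => [|||||f IHf g IHg|f IHf g IHg|f IHf g IHg|f IHf] n r K /=.
- by move=> ->; apply: reaches_step (reaches_refl _ _) => k; machine.
- by move=> ->; apply: reaches_step (reaches_refl _ _) => k; machine.
- by move=> ->; apply: reaches_step (reaches_refl _ _) => k; machine.
- by move=> ->; apply: reaches_step (reaches_refl _ _) => k; machine.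
- move=> ->; exists n.+1, 1 => k nk.
  by machine; rewrite size_mkseq nk nth_mkseq.
- move=> [a [b [fa gb ->]]].
  apply: reaches_step => [k|]; first by machine; reflexivity.
  apply: reaches_trans (IHf _ _ _ fa) _.
  apply: reaches_step => [k|]; first by machine; reflexivity.
  apply: reaches_trans (IHg _ _ _ gb) _.
  apply: reaches_step (reaches_refl _ _) => k; by machine.
- move=> [m gm fr].
  apply: reaches_step => [k|]; first by machine; reflexivity.
  exact: reaches_trans (IHg _ _ _ gm) (IHf _ _ _ fr).
- rewrite -{1}(npairK n) of_npair; set a := nfst n; set l := nsnd n.
  case=> s [s0 si ->].
  apply: reaches_step => [k|]; first by machine; reflexivity.
  apply: reaches_trans (IHf _ _ _ s0) _; rewrite -/a -/l.
  have: forall i, i <= l ->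
      reaches q (s 0, rec_frame (code_num g) a 0 l :: K) (s i, rec_frame (code_num g) a i l :: K).
    elim=> [|i IH] il; first exact: reaches_refl.
    apply: reaches_trans (IH (ltnW il)) _.
    apply: reaches_step => [k|]; first by machine; rewrite il; reflexivity.
    exact: IHg (si _ il).
  move=> /(_ l (leqnn l)) /reaches_trans; apply.
  by apply: reaches_step (reaches_refl _ _) => k; machine; rewrite ltnn.
- case=> f0 fk.
  apply: reaches_step => [k|]; first by machine; reflexivity.
  have: forall i, i <= r ->
      reaches q (npair n 0, [:: code_num f, mu_frame (code_num f) n 0 & K])
                (npair n i, [:: code_num f, mu_frame (code_num f) n i & K]).
    elim=> [|i IH] il; first exact: reaches_refl.
    apply: reaches_trans (IH (ltnW il)) _.
    have [m fm] := fk _ il; apply: reaches_trans (IHf _ _ _ fm) _.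
    by apply: reaches_step (reaches_refl _ _) => k; machine.
  move=> /(_ r (leqnn r)) /reaches_trans; apply.
  apply: reaches_trans (IHf _ _ _ f0) _.
  by apply: reaches_step (reaches_refl _ _) => k; machine.
Qed.

(** If the machine halts with c on top of K, it must first finish c with some value and then halt
    from K in fewer steps. The induction is on the number of steps, because the frames of loops put
    the same program back on the stack. *)
Lemma halted_run q w : (forall i, i < size w -> nth false w i = q i) ->
  forall s c n K v, iter s (step w) (n, code_num c :: K) = (v, [::]) ->
  exists r s', [/\ s' < s, run q c n r & iter s' (step w) (r, K) = (v, [::])].
Proof.
move=> wq; move=> s; have [N] := ubnP s; elim: N s => // N IH [|s] sN c n K v; first by [].
have pop s1 v1 e K1 : iter s1 (step w) (v1, e :: K1) = (v, [::]) ->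
    exists2 s2, s2 < s1 & iter s2 (step w) (frame_step w v1 e K1) = (v, [::]).
  by case: s1 => // s1; rewrite iterSr => h; exists s1.
move=> /pop[s0 s0s]; rewrite ltnS in sN; rewrite ltnS in s0s.
have {sN}s0N := leq_ltn_trans s0s sN.
case: c => [|||||f g|f g|f g|f] /=; frame.
- by exists 0, s0.
- by exists n.+1, s0.
- by exists (nfst n), s0.
- by exists (nsnd n), s0.
- case: ifP => nw h; first by exists (nth false w n), s0; rewrite wq // in h *.
  (* A blocked query is a fixed point of [step] with nonempty stack, which contradicts halting. *)
  have e : step w (n, npair 4 0 :: K) = (n, npair 4 0 :: K).
    by machine; rewrite nw.
  by rewrite iter_fix in h.
- move=> /IH[|a [s1 [s10 fa /pop[s2 s21]]]]; first by lia.
  frame; move=> /IH[|b [s3 [s32 gb /pop[s4 s43]]]]; first by lia.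
  frame; move=> h; exists (npair a b), s4; split=> //; first lia.
  by exists a, b.
- move=> /IH[|m [s1 [s10 gm]]]; first by lia.
  move=> /IH[|r [s2 [s21 fr h]]]; first by lia.
  by exists r, s2; split=> //; [lia|exists m].
- move=> /IH[|a [s1 [s10 fa]]]; first by lia.
  (* Induction on the number d of remaining rounds. The trace is assembled from its end: the current
     value is put in front of the trace of the later rounds. *)
  have : forall d i s1 b, nsnd n - i = d -> s1 < s0 -> 
      iter s1 (step w) (b, rec_frame (code_num g) (nfst n) i (nsnd n) :: K) = (v, [::]) ->
      exists t s2, [/\ t i = b, forall j, i <= j < nsnd n ->
             run q g (npair (nfst n) (npair j (t j))) (t j.+1),
            s2 < s0 & iter s2 (step w) (t (maxn i (nsnd n)), K) = (v, [::])].
    elim=> [|d IHd] i s2 b di s20 /pop[s3 s32]; frame.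
      rewrite ifF; last by lia.
      move=> h; exists (fun _ => b), s3; split=> //; [by move=> j; lia|lia].
    rewrite ifT; last by lia.
    move=> /IH[|b' [s4 [s43 gb]]]; first by lia.
    move=> /IHd[||t [s5 [ti tj s50 h]]]; [lia|lia|].
    exists (fun j => if j <= i then b else t j), s5; split=> //.
    - by rewrite leqnn.
    - move=> j /andP[ij jn]; case: (ltngtP j i) ij => // ij _ /=.
        by apply: tj; rewrite ij.
      by rewrite ij ti.
    - by move: h; rewrite (maxn_idPr _) 1?(maxn_idPr _) ?ifF //; lia.
  move=> /[apply] /(_ _ erefl s10)[t [s2 [t0 tj s20]]]; rewrite max0n => h.
  exists (t (nsnd n)), s2; split=> //; first lia.
  rewrite -{1}(npairK n) of_npair; exists t; split=> //; first by rewrite t0.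
(* The number of rounds of a minimisation is not known in advance, so the induction is on the
   machine steps that are left. *)
- have : forall u i, u < s0.+1 ->
      iter u (step w) (npair n i, [:: code_num f, mu_frame (code_num f) n i & K]) = (v, [::]) ->
      exists r s2, [/\ i <= r, run q f (npair n r) 0,
        forall j, i <= j < r -> exists m, run q f (npair n j) m.+1,
        s2 < s0 & iter s2 (step w) (r, K) = (v, [::])].
    move=> u; have [M] := ubnP u; elim: M u =>
      // M IHM u uM i u0 /IH[|b [s2 [s21 fb /pop[s3 s32]]]]; first by lia.
    frame; case: b fb => [|b] fb /= h.
      by exists i, s3; split=> //; [move=> j; lia|lia].
    move: h => /IHM[||r [s4 [ir fr fj s40 h]]]; [lia|lia|].
    exists r, s4; split=> //; first exact: ltnW.
    move=> j /andP[]; rewrite leq_eqVlt => /predU1P[<- _|ij jr]; first by exists b.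
    by apply: fj; rewrite ij.
  move=> /[apply] /(_ (ltnSn _))[r [s2 [_ fr fj s20 h]]].
  by exists r, s2; split=> //; lia.
Qed.

Lemma runP q c n r :
  run q c n r <-> exists k, iter k (step (mkseq q k)) (n, [:: code_num c]) = (r, [::]).
Proof.
split=> [/(run_reaches [::])[m [s h]]|[k]].
  exists (maxn m s); apply: (halted_leq (leq_maxr m s)).
  by apply: h; rewrite leq_maxl.
have wq i : i < size (mkseq q k) -> nth false (mkseq q k) i = q i.
  by rewrite size_mkseq => ik; rewrite nth_mkseq.
by move=> /(halted_run wq)[r' [s' [_ cr]]]; rewrite step_halted => -[<-].
Qed.

Lemma run_halted q c n r : run q c n r ->
  exists m, forall k, m <= k -> iter k (step (mkseq q k)) (n, [:: code_num c]) = (r, [::]).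
Proof.
move=> /(run_reaches [::])[m [s h]]; exists (maxn m s) => k.
by rewrite geq_max => /andP[mk sk]; apply: (halted_leq sk); apply: h.
Qed.

(* The length of the known oracle prefix also bounds the number of steps. *)
Definition machine_run (w : seq bool) (e n : nat) : nat * seq nat :=
  iter (size w) (step w) (n, [:: e]).

Lemma rec_machine_run A (eA : Enc A) (w : (nat -> bool) -> A -> seq bool)
  (e n : (nat -> bool) -> A -> nat) :
  recursive w -> recursive e -> recursive n ->
  recursive (fun o a => machine_run (w o a) (e o a) (n o a)).
Proof.
move=> rw re rn.
have rs : recursive (fun o (p : A * (nat * seq nat)) => step (w o p.1) p.2).
  apply: (rec_comp2 (F := fun _ => step) rec_step); rec.
  by apply: (rec_comp (F := w)); rec.
exact: (rec_iter (g := fun o a => step (w o a)) (rec_size rw) rs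
         (rec_pair rn (rec_cons re (rec_cst [::])))).
Qed.

Lemma machine_runP q c n r :
  run q c n r <-> exists k, machine_run (mkseq q k) (code_num c) n = (r, [::]).
Proof. by rewrite runP; split=> -[k h]; exists k; move: h; rewrite /machine_run size_mkseq. Qed.

Lemma run_machine_run q c n r : run q c n r ->
  exists m, forall k, m <= k -> machine_run (mkseq q k) (code_num c) n = (r, [::]).
Proof.
by move=> /run_halted[m h]; exists m => k mk; rewrite /machine_run size_mkseq h.
Qed.

Lemma nilp_pair (T : eqType) (st : nat * seq T) v :
  (st == (v, [::])) = (st.1 == v) && nilp st.2.
Proof. by case: st => a [|b s]; rewrite -pair_eqE. Qed.

Lemma rec_nilp A T (eA : Enc A) (eT : Enc T) (l : (nat -> bool) -> A -> seq T) :
  recursive l -> recursive (fun o a => nilp (l o a)).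
Proof. by move=> rl; rewrite /nilp; rec. Qed.

(** Taking all k up to s into account makes the stage predicate monotone, which later allows two
    stages to be merged into their maximum. *)
Lemma re_Kleene (E : set nat) : recursively_enumerable E ->
  exists T : nat -> nat -> bool,
    [/\ recursive (fun _ (p : nat * nat) => T p.1 p.2),
        forall n, E n <-> exists s, T n s
      & forall n s s', s <= s' -> T n s -> T n s'].
Proof.
case=> c cP.
pose H n k := nilp (machine_run (mkseq no_oracle k) (code_num c) n).2.
exists (fun n s => has (fun k => H n k) (iota 0 s.+1)); split.
- rec; rewrite /H; apply: rec_nilp; apply: rec_snd; apply: rec_machine_run; rec.
  exact: (rec_cst false).
- move=> n; rewrite cP; split=> [[r /machine_runP[k h]]|[s /hasP[k _]]].
    exists k; apply/hasP; exists k; first by rewrite mem_iota add0n ltnSn.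
    by rewrite /H h.
  rewrite /H; case E1 : machine_run => [r [|//]] _; exists r.
  by apply/machine_runP; exists k.
- move=> n s s' ss' /hasP[k]; rewrite mem_iota add0n => /andP[_ ks] Hk.
  by apply/hasP; exists k; rewrite // mem_iota add0n (leq_trans ks).
Qed.

(** Every number codes a list of naturals, and the list is a binary word when its entries are at
    most 1. The search predicate ignores its counter: the program stops at 0 or never. *)
Lemma re_words (D : seq bool -> bool) :
  recursive (fun _ w => D w) ->
  recursively_enumerable [set CodeSeq.code (map nat_of_bool w) | w in [set w | D w]]%classic.
Proof.
move=> rD; pose t (s : seq nat) := all (fun x => x <= 1) s && D (map (fun x => x == 1) s).
have rt : recursive (fun _ (p : seq nat * nat) => t p.1).
  rewrite /t; rec; apply: (rec_comp (F := fun _ => D) rD); rec.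
have [c cP] := mu_code (g := fun _ s _ => t s) rt.
exists c => n; rewrite -(CodeSeq.decodeK n); set s := CodeSeq.decode n.
have es : enc s = CodeSeq.code s by rewrite /enc /enc_seq map_id.
rewrite -es; split=> [[w Dw]|[r]].
  rewrite es => /(can_inj CodeSeq.codeK) ws; exists 0; rewrite -es; apply/cP; split=> //.
  rewrite /t -ws all_map -map_comp; apply/andP; split; first by apply/allP => -[].
  by rewrite (eq_map (_ : _ =1 id)) ?map_id // => -[].
move=> /cP[ts _].
exists (map (fun x => x == 1) s); first by case/andP: ts.
rewrite es; congr CodeSeq.code; case/andP: ts => /allP s1 _.
rewrite -map_comp -[RHS]map_id; apply/eq_in_map => x /s1 /=; by case: x => [|[]].
Qed.

Lemma decidable_re (E : set nat) : decidable_set E -> recursively_enumerable E.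
Proof.
move=> /rec_of_computable dE.
have rD : recursive (fun _ n => `[< E n >]) by apply: rec_unraw.
have [c cP] := mu_code (g := fun _ n _ => `[< E n >]) (rec_comp rD (rec_fst rec_id)).
exists c => n; split=> [En|[r /cP[/asboolP]]] //.
by exists 0; apply/cP; split=> //; apply/asboolP.
Qed.

(** * Effectively closed classes and the maximal degree *)

Local Open Scope classical_set_scope.

(** A word is forbidden when the machine, knowing only this word and running for its length, outputs
    1 at some n below that length. A violation [F q n] uses finitely many bits and steps, so it
    shows in some prefix of q. *)
Lemma Pi01_of_recursive (F : (nat -> bool) -> nat -> bool) :
  recursive F -> Pi01 [set q | forall n, ~~ F q n].
Proof.
case=> c cP.
pose D w := has (fun n => machine_run w (code_num c) n == (1, [::])) (iota 0 (size w)).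
exists [set w | D w].
  apply: re_words.
  have : recursive (fun _ w => has (fun n => ((machine_run w (code_num c) n).1 == 1)
             && nilp (machine_run w (code_num c) n).2) (iota 0 (size w))).
    rec; last apply: rec_nilp; rec.
      by apply: rec_machine_run; rec.
    by apply: rec_machine_run; rec.
  by apply: rec_eq => _ w; apply: eq_has => n; rewrite nilp_pair.
apply/seteqP; split=> q /= h n.
  move=> /hasP[m _ /eqP e].
  have /machine_runP /run_inj /(_ (cP q m)) :
    exists k, machine_run (mkseq q k) (code_num c) m = (1, [::]).
    by exists n.
  by move: (h m); case: (F q m).
apply/negP => Fn; have := cP q n; rewrite Fn => /run_machine_run[m hm].
apply: (h (maxn m n.+1)); apply/hasP; exists n.
  by rewrite mem_iota add0n size_mkseq leq_maxr.
by rewrite hm // leq_maxl.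
Qed.

Lemma Pi01_stages (P : set (nat -> bool)) : Pi01 P ->
  exists T : seq bool -> nat -> bool,
    [/\ recursive (fun _ (p : seq bool * nat) => T p.1 p.2),
        P = [set q | forall n s, ~~ T (mkseq q n) s]
      & forall w s s', s <= s' -> T w s -> T w s'].
Proof.
case=> W /re_Kleene[T [rT TP Tmono]] ->.
exists (fun w s => T (enc w) s); split; last by move=> w; apply: Tmono.
  by apply: (rec_comp2 (F := fun _ => T) rT); rec; apply: rec_raw; rec.
have TW w : W w <-> exists s, T (enc w) s.
  rewrite -TP; split=> [Ww|[w' Ww']]; first by exists w.
  by move=> /(can_inj CodeSeq.codeK) /(inj_map (can_inj oddb)) <-.
apply/seteqP; split=> q /= h n; first by move=> s; apply/negP => Tn; apply: (h n); apply/TW;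
  exists s.
by move=> /TW[s]; apply/negP.
Qed.

(** Only an oracle query looks at the prefix: either both prefixes answer it, and alike, or it
    blocks the shorter one. *)
Lemma step_prefix q k k' st : k <= k' ->
  step (mkseq q k) st = step (mkseq q k') st \/ step (mkseq q k) st = st.
Proof.
move=> kk'; rewrite /step; case: st => v [|e K] /=; first by left.
rewrite /frame_step !size_mkseq; case: ifP => // _; first by left.
do 3! [case: ifP => // _; first by left].
case: ifP => // _; last by left.
case: ltnP => [vk|_]; last by right.
by left; rewrite (leq_trans vk kk') !nth_mkseq // (leq_trans vk).
Qed.

Lemma iter_step_prefix q k k' s st v : k <= k' ->
  iter s (step (mkseq q k)) st = (v, [::]) -> iter s (step (mkseq q k')) st = (v, [::]).
Proof.
move=> kk'; elim: s st => [//|s IH] st; rewrite 2!iterSr.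
case: (step_prefix q st kk') => e; first by rewrite e; apply: IH.
rewrite e iter_fix // => st_halted; rewrite {}st_halted.
by rewrite -iterSr; apply: step_halted.
Qed.

Lemma machine_run_leq q k k' e n v : k <= k' ->
  machine_run (mkseq q k) e n = (v, [::]) -> machine_run (mkseq q k') e n = (v, [::]).
Proof.
move=> kk'; rewrite /machine_run !size_mkseq => h.
by apply: (halted_leq kk'); apply: iter_step_prefix h.
Qed.

(* The separating class of {e | e outputs 0} and {e | e outputs 1}. *)
Definition diagonal_class : set (nat -> bool) :=
  [set q | forall e n s, machine_run (mkseq no_oracle s) e n <> (nat_of_bool (q (npair e n)),
    [::])].

Lemma diagonal_class_Pi01 : Pi01 diagonal_class.
Proof.
pose F (q : nat -> bool) m :=
  let st := machine_run (mkseq no_oracle (nsnd (nsnd m))) (nfst m) (nfst (nsnd m)) in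
  (st.1 == nat_of_bool (q (npair (nfst m) (nfst (nsnd m))))) && nilp st.2.
have rr : recursive (fun _ (m : nat) =>
  machine_run (mkseq no_oracle (nsnd (nsnd m))) (nfst m) (nfst (nsnd m))).
  apply: rec_machine_run; rec.
  exact: (rec_cst false).
have rF : recursive F.
  rewrite /F /=; rec; last by apply: rec_nilp; rec.
have -> : diagonal_class = [set q | forall m, ~~ F q m].
  apply/seteqP; split=> q /= h.
    by move=> m; rewrite /F -nilp_pair; apply/eqP/h.
  move=> e n s eq1; have := h (npair e (npair n s)).
  by rewrite /F !(nfst_pair, nsnd_pair) -nilp_pair eq1 eqxx.
exact: Pi01_of_recursive.
Qed.

(** The witness is [true] exactly where the program halts with output 0. Longer runs keep the
    outcome of shorter ones, so no program outputs 0 at one stage and 1 at another. *)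
Lemma diagonal_class_neq0 : diagonal_class !=set0.
Proof.
exists (fun k => `[< exists s, machine_run (mkseq no_oracle s) (nfst k) (nsnd k) = (0, [::]) >]).
move=> e n s; rewrite nfst_pair nsnd_pair; case: asboolP => [[s' h']|h0] h.
  have := machine_run_leq (leq_maxl s s') h; have := machine_run_leq (leq_maxr s s') h'.
  by move=> -> [].
by apply: h0; exists s.
Qed.

Fixpoint bitwords k : seq (seq bool) :=
  if k is k'.+1 then map (cons true) (bitwords k') ++ map (cons false) (bitwords k')
  else [:: [::]].

Lemma mem_bitwords k w : (w \in bitwords k) = (size w == k).
Proof.
elim: k w => [|k IH] [|b w] //=; rewrite ?mem_cat.
  by apply/negP => /orP[] /mapP[].
rewrite eqSS -IH; apply/idP/idP => [/orP[] /mapP[w' w'k [_ ->]] //|wk].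
by case: b; rewrite (map_f (cons _) wk) ?orbT.
Qed.

Lemma rec_bitwords A (eA : Enc A) (k : (nat -> bool) -> A -> nat) :
  recursive k -> recursive (fun o a => bitwords (k o a)).
Proof.
move=> rk.
have rs : recursive (fun _ (p : A * seq (seq bool)) => map (fun w =>
  true :: w) p.2 ++ map (fun w => false :: w) p.2).
  rec.
apply: rec_eq (rec_iter (g := fun _ _ L =>
  map (cons true) L ++ map (cons false) L) rk rs (rec_cst [:: [::]])) => o a.
by elim: (k o a) => //= n ->.
Qed.

Section Maximal.
Variable T : seq bool -> nat -> bool.
Hypothesis rT : recursive (fun _ (p : seq bool * nat) => T p.1 p.2).
Hypothesis T_mono : forall w s s', s <= s' -> T w s -> T w s'.

(* A finite witness that no element of the class extends [w]. *)
Definition dead (w : seq bool) k :=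
  all (fun t => has (fun i => T (take i (w ++ t)) k) (iota 0 (size w + k).+1)) (bitwords k).

Lemma deadP w k : reflect (forall t, size t = k ->
  exists2 i, i <= size w + k & T (take i (w ++ t)) k) (dead w k).
Proof.
apply: (iffP allP) => h t.
  move=> tk; have := h t; rewrite mem_bitwords tk eqxx => /(_ isT) /hasP[i].
  by rewrite mem_iota add0n ltnS; exists i.
rewrite mem_bitwords => /eqP /h[i ik Ti]; apply/hasP; exists i => //.
by rewrite mem_iota add0n ltnS.
Qed.

Lemma dead_mono w k k' : k <= k' -> dead w k -> dead w k'.
Proof.
move=> kk' /deadP h; apply/deadP => t tk.
have [|i ik Ti] := h (take k t); first by rewrite size_take tk; case: ltngtP kk'.
exists i; first by rewrite (leq_trans ik) // leq_add2l.
move: Ti; have -> : w ++ take k t = take (size w + k) (w ++ t) by rewrite take_cat ltnNge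
  leq_addr /= addKn.
by rewrite take_takel //; apply: T_mono.
Qed.

Lemma dead_split w k : dead (rcons w true) k -> dead (rcons w false) k -> dead w k.+1.
Proof.
move=> /deadP ht /deadP hf; apply/deadP => -[//|b t] [tk].
have [i ik Ti] : exists2 i, i <= size (rcons w b) + k & T (take i (rcons w b ++ t)) k.
  by case: b; [apply: ht|apply: hf].
exists i; first by move: ik; rewrite size_rcons addSnnS.
by rewrite -cat_rcons; apply: T_mono Ti.
Qed.

Lemma rec_dead A (eA : Enc A) (w : (nat -> bool) -> A -> seq bool) (k : (nat -> bool) -> A ->
  nat) :
  recursive w -> recursive k -> recursive (fun o a => dead (w o a) (k o a)).
Proof.
move=> rw rk.
have r : recursive (fun _ (p : (seq bool * nat) * seq bool) =>
    has (fun i => T (take i (p.1.1 ++ p.2)) p.1.2) (iota 0 (size p.1.1 + p.1.2).+1)).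
  by rec; apply: (rec_comp2 (F := fun _ => T) rT); rec.
have rd : recursive (fun _ (p : seq bool * nat) => dead p.1 p.2).
  by apply: rec_all; [exact: r|apply: rec_bitwords; rec].
exact: (rec_comp2 (F := fun _ => dead) rd).
Qed.

(** The program waits until a child of w is seen to be dead and then outputs the name of that child.
    When the sibling never dies there is no ambiguity, and a member of the diagonal class is forced
    to differ from this output. *)
Lemma killer_code : exists c, forall w b k, dead (rcons w b) k ->
  (forall k', ~~ dead (rcons w (~~ b)) k') -> run no_oracle c (enc w) b.
Proof.
have [c cP] := mu_code (g := fun _ w k => dead (rcons w true) k || dead (rcons w false) k)
  (rec_orb (rec_dead (rec_rcons (rec_fst rec_id) (rec_cst true)) (rec_snd rec_id))
           (rec_dead (rec_rcons (rec_fst rec_id) (rec_cst false)) (rec_snd rec_id))).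
have [d dP] : recursive (fun _ (p : seq bool * nat) => dead (rcons p.1 true) p.2).
  by apply: rec_dead; rec.
have [ci iP] : recursive (fun _ (w : seq bool) => w) by exact: rec_id.
exists (Comp d (Pair ci c)) => w b k kb nb.
pose P k := dead (rcons w true) k || dead (rcons w false) k.
have exP : exists k, P k by exists k; rewrite /P; case: (b) kb => ->; rewrite ?orbT.
case: (ex_minnP exP) => m Pm mmin.
exists (enc (w, m)).
  exists (enc w), m; split; [exact: (iP no_oracle w)| |by []].
  by apply/cP; split=> // j jm; apply/negP => /mmin; rewrite leqNgt jm.
have -> : nat_of_bool b = enc (dead (rcons w true) m); last exact: (dP _ (w, m)).
have := nb m; case: (b) => /= ndm; move: Pm; rewrite /P (negbTE ndm) ?orbF ?orFb.
  by move=> ->.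
by [].
Qed.

(* Follow, from the root, the child that the killer program does not name. *)
Definition follow_oracle e (q : nat -> bool) n : seq bool :=
  iter n (fun w => rcons w (q (npair e (enc w)))) [::].

Lemma rec_follow_oracle e : recursive (fun q n => q (npair e (enc (follow_oracle e q n)))).
Proof.
have r : recursive (fun q n => follow_oracle e q n).
  apply: (rec_iter (g := fun q _ w => rcons w (q (npair e (enc w))))); rec.
  by apply: rec_raw; rec.
rec; exact: rec_raw.
Qed.

Lemma follow_oracleE e q n :
  follow_oracle e q n = mkseq (fun n => q (npair e (enc (follow_oracle e q n)))) n.
Proof. by elim: n => // n IH; rewrite mkseqS -IH. Qed.

End Maximal.

(** The path chosen by q never reaches a dead node. The root is alive since P is nonempty. If the
    chosen child of a live node were dead, its sibling could never die, as the node itself would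
    then be dead; so the killer program would output the very bit chosen by q, against the diagonal
    property. *)
Lemma diagonal_class_maximal (P : set (nat -> bool)) :
  Pi01 P -> P !=set0 -> medvedev_le P diagonal_class.
Proof.
move=> /Pi01_stages[T [rT -> Tmono]] [x0 Px0].
have [c cP] := killer_code rT.
pose e := code_num c.
apply: medvedev_le_rec (rec_follow_oracle e) _ => q Qq /=.
have alive n k : ~~ dead T (follow_oracle e q n) k.
  elim: n k => [|n IH] k.
    apply/negP => /deadP /(_ (mkseq x0 k) (size_mkseq _ _))[i]; rewrite cat0s add0n => ik Ti.
    have /negP := Px0 i k; apply; move: Ti.
    by rewrite /mkseq -map_take take_iota (minn_idPl ik).
  rewrite [follow_oracle _ _ _]/=; set w := follow_oracle e q n; set b := q _.
  apply/negP => db.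
  have sib k' : ~~ dead T (rcons w (~~ b)) k'.
    apply/negP => db'.
    have h1 : dead T (rcons w b) (maxn k k') by apply: dead_mono db; rewrite // leq_maxl.
    have h2 : dead T (rcons w (~~ b)) (maxn k k') by apply: dead_mono db'; rewrite // leq_maxr.
    have /negP := IH (maxn k k').+1; apply; rewrite -/w.
    by case: (b) h1 h2 => /= h1 h2; apply: dead_split.
  have /run_machine_run[m /(_ m (leqnn m))] := cP w b k db sib.
  exact: Qq.
move=> n s; rewrite -follow_oracleE; apply/negP => Ts; have /negP := alive n s; apply.
apply/deadP => t _; exists (size (follow_oracle e q n)); first by rewrite leq_addr.
by rewrite take_size_cat.
Qed.

Lemma diagonal_class_degree : is_maximal_Pi01_degree (degree_of diagonal_class).
Proof.
have QQ := medvedev_le_refl diagonal_class.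
split; first by exists diagonal_class => //; split;
  [exact: diagonal_class_Pi01|exact: diagonal_class_neq0].
move=> _ [P [P1 P0] <-]; exists P, diagonal_class; split=> //; first by split;
  apply: medvedev_le_refl.
exact: diagonal_class_maximal.
Qed.

(** * Words and codings of subshifts *)

(** A cascade of equality tests of codes along [enum T]: it suffices to treat each value of a finite
    type as a constant. *)
Lemma rec_case_fin A B (T : finType) (eA : Enc A) (eB : Enc B) (eT : Enc T)
  (k : (nat -> bool) -> A -> T) (F : T -> (nat -> bool) -> A -> B) :
  injective (@enc T eT) -> recursive k -> (forall t, recursive (F t)) ->
  recursive (fun o a => F (k o a) o a).
Proof.
(* If [T] is empty, then so is [A] because of [k], and any program will do. *)
move=> inj rk rF; case: (pickP (@predT T)) => [t0 _|T0]; last by exists Zero => o a;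
  have := T0 (k o a).
have [G rG GP] : exists2 G : (nat -> bool) -> A -> B,
    recursive G & forall o a, k o a \in enum T -> G o a = F (k o a) o a.
  elim: (enum T) => [|t s [G rG GP]]; first by exists (F t0).
  exists (fun o a => if enc (k o a) == enc t then F t o a else G o a).
    have := rec_raw rk; have := rF t; move=> r1 r2; rec.
  move=> o a; rewrite (inj_eq inj) inE; by case: eqP => [->//|_ /GP].
by apply: rec_eq rG => o a; rewrite GP // mem_enum.
Qed.

#[export] Instance enc_letter k : Enc (letter k) := fun l => (nat_of_ord l.1).*2 + l.2.

Lemma enc_letter_inj k : injective (@enc _ (@enc_letter k)).
Proof.
move=> [i b] [j c]; rewrite /enc /enc_letter /= => e.
have bc : b = c by have := congr1 odd e; rewrite !oddD !odd_double !addFb !oddb.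
have ij : i = j :> nat by apply: double_inj; apply: (@addIn b); rewrite e bc.
by rewrite bc (val_inj ij).
Qed.

Lemma rec_word_code A (eA : Enc A) k (f : (nat -> bool) -> A -> seq (letter k)) :
  recursive f -> recursive (fun o a => word_code (f o a)).
Proof. exact: rec_raw. Qed.

Lemma enc_word_inj k : injective (@enc _ (enc_seq (@enc_letter k))).
Proof. by move=> u v /(can_inj CodeSeq.codeK) /(inj_map (@enc_letter_inj k)). Qed.

(* Not an instance: [bool] and the like have their own encodings. *)
Definition enc_fin (A : finType) : Enc A := fun a => nat_of_ord (enum_rank a).

Lemma enc_fin_inj (A : finType) : injective (@enc A (@enc_fin A)).
Proof. by move=> a b /val_inj /enum_rank_inj. Qed.

Lemma rec_eq_fin A (eA : Enc A) (T : finType) (f g : (nat -> bool) -> A -> T) :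
  recursive (eB := @enc_fin T) f -> recursive (eB := @enc_fin T) g ->
  recursive (fun o a => f o a == g o a).
Proof.
move=> rf rg; apply: rec_eq (rec_eqn (rec_raw rf) (rec_raw rg)) => o a.
by rewrite (inj_eq (@enc_fin_inj T)).
Qed.

Section Words.
Variable k : nat.
Implicit Types (l : letter k) (w u : seq (letter k)).

Definition push_letter l w :=
  if w is l' :: w' then if (l.1 == l'.1) && (l.2 != l'.2) then w' else l :: w else [:: l].

Definition reduce w := foldr push_letter [::] w.

Lemma reduce_reduced w : reduced (reduce w).
Proof.
elim: w => //= l w; case: (reduce w) => [|l' w'] //= h.
case: ifP => c; first exact: path_sorted h.
by rewrite /reduced /= c.
Qed.

Lemma reduce_id w : reduced w -> reduce w = w.
Proof.
elim: w => // l w IH lw.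
rewrite -[LHS]/(push_letter l (reduce w)) (IH (path_sorted lw)).
by case: w lw {IH} => //= l' w' /andP[/negbTE ->].
Qed.

Lemma rec_reduce A (eA : Enc A) (f : (nat -> bool) -> A -> seq (letter k)) :
  recursive f -> recursive (fun o a => reduce (f o a)).
Proof.
move=> rf; apply: (rec_foldr (g := fun _ _ => push_letter)) => //; last exact: rec_cst.
apply: (@rec_case_fin _ _ _ _ _ _ (fun _ (p : A * (letter k * seq (letter k))) => p.2.1)
  (fun l _ p => push_letter l p.2.2)); [exact: enc_letter_inj|by rec|move=> l].
apply: (@rec_case_seq _ _ _ _ _ _ (fun _ (p : A * (letter k * seq (letter k))) => p.2.2)
  (fun _ _ => [:: l]) (fun _ p l' w' =>
    if (l.1 == l'.1) && (l.2 != l'.2) then w' else l :: p.2.2)); [by rec|exact: rec_cst|].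
apply: (@rec_case_fin _ _ _ _ _ _ 
  (fun _ (p : (A * (letter k * seq (letter k))) * (letter k * seq (letter k))) => p.2.1)
  (fun l' _ p => if (l.1 == l'.1) && (l.2 != l'.2) then p.2.2 else l :: p.1.2.2));
  [exact: enc_letter_inj|by rec|move=> l'].
by cbv beta; case: (_ && _); rec.
Qed.

Definition inverse_word w := rev [seq (l.1, ~~ l.2) | l <- w].

Lemma rec_inverse_word A (eA : Enc A) (f : (nat -> bool) -> A -> seq (letter k)) :
  recursive f -> recursive (fun o a => inverse_word (f o a)).
Proof.
move=> rf; apply: rec_rev; apply: (rec_map (g := fun _ _ l => (l.1, ~~ l.2) : letter k)) => //.
apply: (@rec_case_fin _ _ _ _ _ _ (fun _ (p : A * letter k) => p.2) (fun l _ _ =>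
  (l.1, ~~ l.2) : letter k)).
- exact: enc_letter_inj.
- by rec.
- by move=> l; apply: rec_cst.
Qed.

Variables (G : groupType) (s : 'I_k -> G).

Definition letter_eval l : G := (if l.2 then (s l.1)^-1 else s l.1)%g.

Lemma word_eval_nil : word_eval s [::] = 1%g.
Proof. exact: big_nil. Qed.

Lemma word_eval_cons l w : word_eval s (l :: w) = (letter_eval l * word_eval s w)%g.
Proof. exact: big_cons. Qed.

Lemma word_eval1 l : word_eval s [:: l] = letter_eval l.
Proof. exact: big_seq1. Qed.

Lemma word_eval_cat w u : word_eval s (w ++ u) = (word_eval s w * word_eval s u)%g.
Proof. exact: big_cat. Qed.

Lemma letter_evalN l : letter_eval (l.1, ~~ l.2) = ((letter_eval l)^-1)%g.
Proof. by rewrite /letter_eval /=; case: l.2; rewrite ?invgK. Qed.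

Lemma word_eval_reduce w : word_eval s (reduce w) = word_eval s w.
Proof.
elim: w => //= l w; rewrite word_eval_cons => <-.
case: (reduce w) => [|l' w'] /=; first by rewrite word_eval_cons.
case: ifP => [/andP[/eqP e1 e2]|_]; rewrite !word_eval_cons //.
have -> : l = (l'.1, ~~ l'.2) by case: l e1 e2 => i b /= -> ; case: b l'.2 => [] [].
by rewrite letter_evalN mulKg.
Qed.

Lemma word_eval_inverse w : word_eval s (inverse_word w) = ((word_eval s w)^-1)%g.
Proof.
elim: w => [|l w IH]; first by rewrite word_eval_nil invg1.
rewrite /inverse_word /= rev_cons -cats1 word_eval_cat -/(inverse_word w) IH.
by rewrite word_eval1 letter_evalN word_eval_cons invgM.
Qed.

End Words.

Section Coding.
Variables (G : groupType) (S : fin_gen G) (A : finType).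
Let word := seq (letter (rank S)).
Local Existing Instance enc_fin | 100.

Lemma rec_enum_free B (eB : Enc B) (f : (nat -> bool) -> B -> nat) :
  recursive f -> recursive (fun o b => val (enum_free S (f o b))).
Proof.
move=> rf; apply: rec_unraw.
exact: (rec_comp (F := fun _ n =>
  word_code (val (enum_free S n))) (rec_of_computable (enum_free_computable S)) rf).
Qed.

(** Only the enumeration of the free group is given as computable; its inverse is obtained by
    unbounded search, with words compared through their codes. *)
Definition free_index_pred (w : word) n := enc (val (enum_free S n)) == enc (reduce w).

Lemma free_index_ex (_ : nat -> bool) (w : word) : exists n, free_index_pred w n.
Proof.
have [g _ gK] := enum_free_bij S.
exists (g (Sub (reduce w) (reduce_reduced w))); by rewrite /free_index_pred gK SubK.
Qed.

Definition free_index w := ex_minn (free_index_ex no_oracle w).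

Lemma free_indexP w : val (enum_free S (free_index w)) = reduce w.
Proof. by rewrite /free_index; case: ex_minnP => n /eqP /enc_word_inj. Qed.

Lemma rec_free_index B (eB : Enc B) (f : (nat -> bool) -> B -> word) :
  recursive f -> recursive (fun o b => free_index (f o b)).
Proof.
have r : recursive (fun o (w : word) => ex_minn (free_index_ex o w)).
  apply: rec_mu; rewrite /free_index_pred; apply: rec_eqn; apply: rec_raw.
    by apply: rec_enum_free; rec.
  by apply: rec_reduce; rec.
have r' : recursive (fun _ w => free_index w) by apply: rec_eq r => o w; apply: eq_ex_minn.
exact: (rec_comp (F := fun _ => free_index) r').
Qed.

Variable a0 : A.

(** The first letter whose bit is set in the n-th block, with [a0] as default: the reading is total
    even on sequences that code no configuration, as [recursive] demands. *)
Definition block_letter (q : nat -> bool) n : A :=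
  foldr (fun b c => if q (n * #|A| + enum_rank b) then b else c) a0 (enum A).

Definition letter_at q (w : word) : A := block_letter q (free_index w).

Lemma rec_block_letter B (eB : Enc B) (f : (nat -> bool) -> B -> nat) :
  recursive f -> recursive (fun o b => block_letter o (f o b)).
Proof.
move=> rf; rewrite /block_letter; elim: (enum A) => [|b s IH] /=; first exact: rec_cst.
by rec.
Qed.

Lemma rec_letter_at B (eB : Enc B) (f : (nat -> bool) -> B -> word) :
  recursive f -> recursive (fun o b => letter_at o (f o b)).
Proof. by move=> rf; apply: rec_block_letter; apply: rec_free_index. Qed.

Definition word_coding (f : word -> A) : nat -> bool :=
  fun n => nat_of_ord (enum_rank (f (val (enum_free S (n %/ #|A|))))) == n %% #|A|.

Lemma rec_word_coding (M : (nat -> bool) -> word -> A) :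
  recursive M -> recursive (fun o => word_coding (M o)).
Proof.
move=> rM; apply: rec_eqn; last by rec.
apply: rec_raw; apply: (rec_comp rM); apply: rec_enum_free; rec.
Qed.

Lemma block_letter_coding f n : block_letter (word_coding f) n = f (val (enum_free S n)).
Proof.
have A0 : 0 < #|A| by apply/card_gt0P; exists a0.
rewrite /block_letter.
have e b : word_coding f (n * #|A| + enum_rank b) = (f (val (enum_free S n)) == b).
  rewrite /word_coding divnMDl // divn_small // addn0 modnMDl modn_small //.
  by rewrite -(inj_eq enum_rank_inj).
have : f (val (enum_free S n)) \in enum A by rewrite mem_enum.
elim: (enum A) => //= b s IH; rewrite e inE; by case: eqP => // _ /IH.
Qed.

Lemma letter_at_coding f w : letter_at (word_coding f) w = f (reduce w).
Proof. by rewrite /letter_at block_letter_coding free_indexP. Qed.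

Lemma codedP (X : set (config G A)) q :
  coded S X q <-> exists2 x, X x & q = word_coding (fun w => x (word_eval (gen S) w)).
Proof.
split=> [[_ [x Xx <-] <-]|[x Xx ->]]; first by exists x.
by exists (fun w => x (word_eval (gen S) (val w))); first by exists x.
Qed.

Lemma coded_letter_at (X : set (config G A)) q : coded S X q ->
  exists2 x, X x & forall w, letter_at q w = x (word_eval (gen S) w).
Proof.
by move=> /codedP[x Xx ->]; exists x => // w; rewrite letter_at_coding word_eval_reduce.
Qed.

Lemma coded_le (X : set (config G A)) Q (M : (nat -> bool) -> word -> A) :
  recursive M ->
  (forall q, Q q -> exists2 x, X x & forall w, M q w = x (word_eval (gen S) w)) ->
  medvedev_le (coded S X) Q.
Proof.
move=> rM MQ; apply: medvedev_le_rec (rec_word_coding rM) _ => q /MQ[x Xx Mx].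
by apply/codedP; exists x => //; congr word_coding; apply/funext.
Qed.

End Coding.

Section Translation.
Variables (G1 G2 : groupType) (S1 : fin_gen G1) (S2 : fin_gen G2) (A : finType).
Variable t : letter (rank S2) -> seq (letter (rank S1)).
Local Existing Instance enc_fin | 100.

Definition translate w := flatten (map t w).

Lemma rec_translate B (eB : Enc B) (f : (nat -> bool) -> B -> seq (letter (rank S2))) :
  recursive f -> recursive (fun o b => translate (f o b)).
Proof.
move=> rf; apply: rec_flatten; apply: (rec_map (g := fun _ _ => t)) => //.
apply: (@rec_case_fin _ _ _ _ _ _ (fun _ (p : B * letter (rank S2)) => p.2) (fun l _ _ => t l)).
- exact: enc_letter_inj.
- by rec.
- by move=> l; apply: rec_cst.
Qed.

Lemma word_eval_translate (h : letter (rank S2) -> G1) w :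
  (forall l, word_eval (gen S1) (t l) = h l) ->
  word_eval (gen S1) (translate w) = (\prod_(l <- w) h l)%g.
Proof.
move=> th; elim: w => [|l w IH]; first by rewrite word_eval_nil big_nil.
by rewrite /translate /= word_eval_cat -/(translate w) IH big_cons th.
Qed.

Lemma medvedev_le_translate (X1 : set (config G1 A)) (X2 : set (config G2 A)) :
  (X1 !=set0)%classic ->
  (forall x1, X1 x1 -> exists2 x2, X2 x2 &
     forall w, x1 (word_eval (gen S1) (translate w)) = x2 (word_eval (gen S2) w)) ->
  medvedev_le (coded S2 X2) (coded S1 X1).
Proof.
case=> x0 _ tX; pose a0 : A := x0 1%g.
apply: (@coded_le _ _ _ _ _ (fun q w => letter_at a0 q (translate w))).
  by apply: rec_letter_at; apply: rec_translate; rec.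
move=> q /(coded_letter_at a0)[x1 /tX[x2 X2x2 e] qx]; exists x2 => // w.
by rewrite qx e.
Qed.

End Translation.

(** * Local rules *)

Section Topology.
Variables (G : groupType) (A : finType).
Implicit Types (x y : config G A) (F : seq G).

Definition agree_on F x y := forall g, g \in F -> x g = y g.

Lemma nbhs_agree x F : nbhs x (agree_on F x).
Proof.
elim: F => [|g F IH]; first by apply: (@filterS _ (nbhs x) _ setT); [move=> y _ g|exact: filterT].
have ev : nbhs x (fun y : config G A => x g = y g).
  have := @proj_continuous G (fun _ => discrete_topology A) g x.
  move=> /(_ [set z | x g = z]); apply.
  apply: (@filterS _ (nbhs (x g : discrete_topology A)) _ [set x g]); first by move=> z ->.
  exact: discrete_set1.
apply: filterS (filterI ev IH) => y [yg yF] h; rewrite inE => /predU1P[->//|]; exact: yF.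
Qed.

(** The sets that contain some [agree_on F x] form a filter converging pointwise to x, hence one
    that contains every neighbourhood of x. *)
Lemma agree_nbhs x (U : set (config G A)) : nbhs x U -> exists F, agree_on F x `<=` U.
Proof.
pose FF : set_system (config G A) := [set V | exists F, agree_on F x `<=` V].
have fF : Filter FF.
  split; first by exists [::].
    move=> P Q [F FP] [F' FQ]; exists (F ++ F') => y yF.
    by split; [apply: FP|apply: FQ] => g gF; apply: yF; rewrite mem_cat gF ?orbT.
  by move=> P Q PQ [F FP]; exists F; apply: subset_trans PQ.
have : {ptws, FF --> (x : discrete_topology G -> discrete_topology A)}.
  apply/(@pointwise_cvgP (discrete_topology G) (discrete_topology A)) => g.
  apply/discrete_cvg; exists [:: g] => y /(_ g); rewrite inE eqxx => /(_ isT) e.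
  by rewrite /= e.
by apply.
Qed.

Lemma closed_agree (X : set (config G A)) :
  (forall x, (forall F, exists2 y, X y & agree_on F x y) -> X x) -> closed X.
Proof.
move=> h x clx; apply: h => F.
by have [y [Xy xy]] := clx _ (nbhs_agree x F); exists y.
Qed.

Lemma config_compact : compact [set: config G A].
Proof.
have := @tychonoff G (fun _ => discrete_topology A) (fun _ => setT) _.
have -> : [set f : G -> discrete_topology A | forall i, [set: discrete_topology A] (f i)] = setT.
  by apply/seteqP; split.
apply=> _; apply: finite_compact; exact: finite_finset.
Qed.

Lemma SFT_agree (X : set (config G A)) : is_SFT X ->
  forall x, (forall F, exists2 y, X y & agree_on F x y) -> X x.
Proof.
case=> Fs _ -> x h g p Fp cyl.
have [y yX xy] := h [seq (g^-1 * k)%g | k <- enum_fset (domf p)].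
apply: (yX g p Fp) => k kp; rewrite (cyl k kp); congr Some; rewrite /shift_config.
by apply: xy; apply/mapP; exists k.
Qed.

End Topology.

Section CurtisHedlundLyndon.
Variables (G : groupType) (A B : finType).

(** The Curtis-Hedlund-Lyndon argument. If every window F failed, the nonempty sets [Bad F] would
    generate a proper filter on the compact set Y, with a cluster point z. By continuity [phi] at 1
    is constant on the points of Y that agree with z on some F0; a point of [Bad F0] close to z
    contradicts this. *)
Lemma local_rule (Y : set (config G B)) (phi : config G B -> config G A) :
  closed Y -> {within Y, continuous phi} ->
  exists F : seq G, forall y y', Y y -> Y y' -> agree_on F y y' -> phi y 1%g = phi y' 1%g.
Proof.
move=> clY /subspace_continuousP phiC; apply: contrapT => nF.
pose Bad F := [set y | Y y /\ exists y', [/\ Y y', agree_on F y y' & phi y 1%g <> phi y' 1%g]].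
have Bad0 F : Bad F !=set0.
  apply: contrapT => h; apply: nF; exists F => y y' Yy Yy' yy'; apply: contrapT => ne.
  by apply: h; exists y; split=> //; exists y'.
pose FF : set_system (config G B) := [set V | exists F, Bad F `<=` V].
have fF : ProperFilter FF.
  split; first by case=> F hF; have [y yF] := Bad0 F; exact: (hF y yF).
  split; first by exists [::].
    move=> P Q [F FP] [F' FQ]; exists (F ++ F') => y [Yy [y' [Yy' yF ne]]].
    by split; [apply: FP|apply: FQ]; split=> //; exists y'; split=> // g gF; apply: yF;
      rewrite mem_cat gF ?orbT.
  by move=> P Q PQ [F FP]; exists F; apply: subset_trans PQ.
have cY : compact Y := subclosed_compact clY (@config_compact G B) (@subsetT _ Y).
have [|z [Yz clz]] := cY FF fF; first by exists [::] => y [].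
have : nbhs z (fun y => Y y -> phi y 1%g = phi z 1%g).
  have := phiC z Yz (agree_on [:: 1%g] (phi z)) (nbhs_agree _ _).
  move=> h; apply: (@filterS _ (nbhs z) _ _ _ _ h) => y /[apply] /(_ 1%g).
  by rewrite inE eqxx => /(_ isT) ->.
move=> /agree_nbhs[F0 F0z].
have [y [[Yy [y' [Yy' yy' ne]]] zy]] :=
  clz (Bad F0) (agree_on F0 z) (ex_intro _ F0 (@subset_refl _ _)) (nbhs_agree z F0).
apply: ne; rewrite (F0z y) // (F0z y') // => g gF; by rewrite zy // yy'.
Qed.

End CurtisHedlundLyndon.

Section SoficDegree.
Variables (G : groupType) (S : fin_gen G) (A B : finType).
Local Existing Instance enc_fin | 100.

(** A finite lookup table is computable whatever its entries are: branching on one letter at a time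
    turns it into constants. *)
Lemma rec_table (L : (nat -> bool) -> seq (letter (rank S)) ->
  B) (us : seq (seq (letter (rank S))))
  (mu : seq B -> A) :
  recursive L -> recursive (fun q w => mu [seq L q (w ++ u) | u <- us]).
Proof.
move=> rL; elim: us mu => [|u us IH] mu /=; first exact: rec_cst.
apply: (@rec_case_fin _ _ _ _ _ _ (fun q w => L q (w ++ u))
  (fun b q w => mu (b :: [seq L q (w ++ u) | u <- us]))).
- exact: enc_fin_inj.
- by apply: (rec_comp rL); rec.
- by move=> b; apply: (IH (fun s => mu (b :: s))).
Qed.

(** The window of the local rule is turned into finitely many words u, so the letter of [phi y] at w
    is looked up from the letters of y at the words w ++ u. *)
Lemma factor_le (Y : set (config G B)) (phi : config G B -> config G A) :
  is_SFT Y -> Y !=set0 -> {within Y, continuous phi} ->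
  (forall g y, Y y -> phi (shift_config g y) = shift_config g (phi y)) ->
  medvedev_le (coded S (phi @` Y)) (coded S Y).
Proof.
move=> sftY [y0 Yy0] phiC phiE.
have [F FP] := local_rule (closed_agree (SFT_agree sftY)) phiC.
have [us usF] : exists us, map (word_eval (gen S)) us = F.
  elim: F {FP} => [|g F [us <-]]; first by exists [::].
  by have [w <-] := gen_surj S g; exists (w :: us).
(* Blocks that occur in no point of Y receive an arbitrary value; on the others the value does not
   depend on the chosen point, by the local rule. *)
pose mu (s : seq B) : A :=
  if pselect (exists2 y, Y y & map y F = s) is left h then phi (sval (cid2 h)) 1%g else phi y0
    1%g.
have muE y : Y y -> mu (map y F) = phi y 1%g.
  move=> Yy; rewrite /mu; case: pselect => [h|[]]; last by exists y.
  case: (cid2 h) => y' Yy' /= e; apply: FP => // g gF.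
  by move/eq_in_map: e; apply.
have shY g y : Y y -> Y (shift_config g y).
  case: sftY => Fs _ -> h k p Fp; have := h (k * g)%g p Fp.
  congr (~ cylinder _ _); apply/funext => a; rewrite /shift_config invgM mulgA.
  by [].
pose b0 : B := y0 1%g.
apply: (@coded_le _ _ _ _ _ (fun q w => mu [seq letter_at b0 q (w ++ u) | u <- us])).
  by apply: rec_table; apply: rec_letter_at; rec.
move=> q /(coded_letter_at b0)[y Yy qy]; exists (phi y); first by exists y.
move=> w; set g := word_eval (gen S) w.
(* These letters form the window at 1 of y shifted by the inverse of g; equivariance then moves the
   rule from 1 to g. *)
have -> : [seq letter_at b0 q (w ++ u) | u <- us] = map (shift_config g^-1%g y) F.
  rewrite -usF -map_comp; apply: eq_map => u /=.
  by rewrite qy word_eval_cat /shift_config invgK.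
by rewrite muE ?phiE //; [rewrite /shift_config invgK mulg1|apply: shY].
Qed.

End SoficDegree.

(** * Decoding the ruler sequence *)

Section Decoder.
Variable k : nat.
Let word := seq (letter k).
(** [None] is a point without pointer. In [Some (l, (c, b))], c is meant as the parity of a 2-adic
    valuation and b as a bit of the encoded sequence. *)
Definition symbol : finType := option (letter k * (bool * bool)).
Implicit Types (f : word -> symbol) (w u : word).

Definition next f w : word := if f w is Some (l, _) then rcons w l else w.

Definition walk f w i : word := iter i (next f) w.

Definition marked (b : bool) (a : symbol) :
  bool := if a is Some (_, (c, _)) then c == b else false.

Definition bit (a : symbol) : bool := if a is Some (_, (_, c)) then c else false.

(** Meant for a distance d = m * 2^j to the identity. For even m both probes have valuation j. For
    odd m they are consecutive multiples of 2^(j+1), so one of them has valuation exactly j+1, of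
    the wrong parity. One probe alone could have valuation j+2 and pass. *)
Definition level_test f w j :=
  marked (odd j) (f (walk f w (2 ^ j))) && marked (odd j) (f (walk f w (3 * 2 ^ j))).

(* Recognises, in a ruler sequence, the positions divisible by exactly 2^n. *)
Definition at_level f n w :=
  all (level_test f w) (iota 0 n) && isSome (f (walk f w (3 * 2 ^ n))) && ~~ level_test f w n.

Definition word_ball m : seq word :=
  iter m (fun L => [::] :: flatten [seq [seq l :: w | w <- L] | l <- enum (letter k : finType)])
    [:: [::]].

Lemma mem_word_ball m w : (w \in word_ball m) = (size w <= m).
Proof.
elim: m w => [|m IH] w; first by rewrite leqn0 size_eq0 inE.
rewrite [word_ball _]/= -/(word_ball m) inE; case: w => [|l w] //=.
apply/flatten_mapP/idP => [[l' _ /mapP[w' w'm [_ ->]]]|wm]; first by rewrite ltnS -IH.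
exists l; first by rewrite mem_enum.
by apply: map_f; rewrite IH.
Qed.

(** When no word of the ball is at level n, [nth] falls back on the empty word, so decoding is
    defined for arbitrary configurations. *)
Definition decode f n : bool :=
  bit (f (nth [::] (word_ball (10 * 2 ^ n)) (find (at_level f n) (word_ball (10 * 2 ^ n))))).

Lemma walk_local f f' w i : (forall u, size u <= size w + i -> f u = f' u) ->
  walk f w i = walk f' w i /\ size (walk f w i) <= size w + i.
Proof.
elim: i => [|i IH] h; first by rewrite addn0.
have [|e s] := IH; first by move=> u ui; apply: h; rewrite addnS leqW.
rewrite /walk !iterS -/(walk f w i) -/(walk f' w i) -e /next -h; last by rewrite addnS leqW.
by split=> //; case: (f _) => [[l _]|]; rewrite ?size_rcons addnS ?ltnS // leqW.
Qed.

(** 13 = 10 + 3: the radius of the searched ball plus the longest walk made from a point of it. *)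
Lemma decode_local f f' n : (forall u, size u <= 13 * 2 ^ n -> f u = f' u) ->
  decode f n = decode f' n.
Proof.
move=> h.
have fw w i : size w <= 10 * 2 ^ n -> i <= 3 * 2 ^ n -> f (walk f w i) = f' (walk f' w i).
  move=> wn ni; have [|e s] := @walk_local f f' w i; first by move=> u ui; apply: h; lia.
  by rewrite -e h //; lia.
have lev w j : size w <= 10 * 2 ^ n -> j <= n -> level_test f w j = level_test f' w j.
  move=> wn jn; have jn2 : 2 ^ j <= 2 ^ n by rewrite leq_exp2l.
  by rewrite /level_test !fw //; lia.
have atl w : size w <= 10 * 2 ^ n -> at_level f n w = at_level f' n w.
  move=> wn; rewrite /at_level fw // lev //; congr (_ && _ && _).
  by apply: eq_in_all => j; rewrite mem_iota add0n => /andP[_ jn]; rewrite lev // ltnW.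
rewrite /decode.
have -> : find (at_level f n) (word_ball (10 * 2 ^ n)) = find (at_level f' n) (word_ball (10 *
  2 ^ n)).
  by apply: eq_in_find => w; rewrite mem_word_ball; apply: atl.
congr bit; apply: h; set L := word_ball _; set i := find _ _.
have : size (nth [::] L i) <= 10 * 2 ^ n.
  case: (ltnP i (size L)) => iL; last by rewrite nth_default.
  by rewrite -mem_word_ball mem_nth.
lia.
Qed.

Section Recursive.
Context {B : Type} {eB : Enc B}.
Local Existing Instance enc_fin | 100.

Lemma rec_word_ball (m : (nat -> bool) -> B -> nat) :
  recursive m -> recursive (fun o b => word_ball (m o b)).
Proof.
move=> rm; apply: (rec_iter (g := fun _ _ L =>
  [::] :: flatten [seq [seq l :: w | w <- L] | l <- enum (letter k : finType)])) => //;
    last exact: rec_cst.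
rec.
Qed.

Variable f : (nat -> bool) -> B -> word -> symbol.
Hypothesis rf : recursive (fun o (p : B * word) => f o p.1 p.2).

Lemma rec_walk : recursive (fun o (p : (B * word) * nat) => walk (f o p.1.1) p.1.2 p.2).
Proof.
apply: (rec_iter (g := fun o (p : (B * word) * nat) => next (f o p.1.1))); rec.
apply: (@rec_case_fin _ _ _ _ _ _ (fun o (p : (B * word) * nat * word) => f o p.1.1.1 p.2)
  (fun a _ p => if a is Some (l, _) then rcons p.2 l else p.2)).
- exact: enc_fin_inj.
- by apply: (rec_comp2 (F := f)) => //; rec.
- by move=> [[l c]|]; rec.
Qed.

Lemma rec_on_walk (C : Type) (eC : Enc C) (t : (nat -> bool) -> C -> B) (w : (nat -> bool) ->
  C -> word)
  (i : (nat -> bool) -> C -> nat) :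
  recursive t -> recursive w -> recursive i ->
  recursive (fun o c => f o (t o c) (walk (f o (t o c)) (w o c) (i o c))).
Proof.
move=> rt rw ri; apply: (rec_comp2 (F := f)) => //.
exact: (rec_comp (F := fun o (p : (B * word) * nat) => walk (f o p.1.1) p.1.2 p.2) rec_walk
  (f := fun o c => ((t o c, w o c), i o c)) (rec_pair (rec_pair rt rw) ri)).
Qed.

Lemma rec_symbol (C D : Type) (eC : Enc C) (eD : Enc D) (h : symbol -> D) (a : (nat -> bool) ->
  C -> symbol) :
  recursive a -> recursive (fun o c => h (a o c)).
Proof.
move=> ra; apply: (rec_case_fin (F := fun a _ _ => h a)) => //; first exact: enc_fin_inj.
by move=> t; apply: rec_cst.
Qed.

Lemma rec_level_test : recursive (fun o (p : (B * word) * nat) =>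
  level_test (f o p.1.1) p.1.2 p.2).
Proof.
have h m : recursive (fun o (p : (B * word) * nat) =>
    marked (odd p.2) (f o p.1.1 (walk (f o p.1.1) p.1.2 (m * 2 ^ p.2)))).
  have r : recursive (fun o (p : (B * word) * nat) => 
      if odd p.2 then marked true (f o p.1.1 (walk (f o p.1.1) p.1.2 (m * 2 ^ p.2)))
      else marked false (f o p.1.1 (walk (f o p.1.1) p.1.2 (m * 2 ^ p.2)))).
    apply: rec_if; first by rec.
      apply: (@rec_symbol _ _ _ _ (marked true)); apply: rec_on_walk; rec.
    apply: (@rec_symbol _ _ _ _ (marked false)); apply: rec_on_walk; rec.
  by apply: rec_eq r => o p; case: ifP.
by apply: rec_eq (rec_andb (h 1) (h 3)) => o p; rewrite /level_test mul1n.
Qed.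

Lemma rec_at_level : recursive (fun o (p : (B * nat) * word) => at_level (f o p.1.1) p.1.2 p.2).
Proof.
have rl (C : Type) (eC : Enc C) (t : (nat -> bool) -> C -> B) (w : (nat -> bool) -> C -> word)
    (i : (nat -> bool) -> C -> nat) : recursive t -> recursive w -> recursive i ->
    recursive (fun o c => level_test (f o (t o c)) (w o c) (i o c)).
  move=> rt rw ri; exact: (rec_comp (F := fun o (p : (B * word) * nat) =>
    level_test (f o p.1.1) p.1.2 p.2)
    rec_level_test (f := fun o c => ((t o c, w o c), i o c)) (rec_pair (rec_pair rt rw) ri)).
apply: rec_andb; first apply: rec_andb.
- apply: rec_all; last by rec.
  by apply: rl; rec.
- by apply: (@rec_symbol _ _ _ _ (isSome)); apply: rec_on_walk; rec.
- by apply: rec_negb; apply: rl; rec.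
Qed.

Lemma rec_find (T : Type) (eT : Enc T) (g : (nat -> bool) -> B -> T -> bool) (l : (nat ->
  bool) -> B -> seq T) :
  recursive (fun o (p : B * T) => g o p.1 p.2) -> recursive l ->
  recursive (fun o b => find (g o b) (l o b)).
Proof.
move=> rg rl.
have rs : recursive (fun o (p : B * (T * nat)) => if g o p.1 p.2.1 then 0 else p.2.2.+1).
  by rec; apply: (rec_comp2 (F := g)); rec.
apply: rec_eq (rec_foldr (g := fun o b x i =>
  if g o b x then 0 else i.+1) rs (rec_cst 0) rl) => o b.
by elim: (l o b) => //= x s ->.
Qed.

End Recursive.

Lemma rec_decode (B : Type) (eB : Enc B) (f : (nat -> bool) -> B -> word -> symbol)
  (n : (nat -> bool) -> B -> nat) :
  recursive (eB := enc_fin (A := symbol)) (fun o (p : B * word) => f o p.1 p.2) -> recursive n ->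
  recursive (fun o b => decode (f o b) (n o b)).
Proof.
move=> rf rn; apply: (@rec_symbol _ _ _ _ (bit)).
apply: (rec_comp2 (F := f) rf); first exact: rec_id.
have rb : recursive (fun o b => word_ball (10 * 2 ^ n o b)).
  by apply: rec_word_ball; rec.
apply: rec_nth => //; first exact: rec_cst.
apply: rec_find => //.
exact: (rec_comp (rec_at_level rf) (f := fun o (p : B * word) => ((p.1, n o p.1), p.2))
  (rec_pair (rec_pair (rec_fst rec_id) (rec_comp rn (rec_fst rec_id))) (rec_snd rec_id))).
Qed.

End Decoder.

(** * The subshift attached to an effectively closed class *)

Section WordLength.
Variables (H : groupType) (S : fin_gen H).
Let word := seq (letter (rank S)).
Local Notation eval := (word_eval (gen S)).
Local Notation leval := (letter_eval (gen S)).
Implicit Types (g h : H) (w u : word).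

Lemma word_len_ex h : exists m, `[< exists2 w, size w = m & eval w = h >].
Proof. by have [w <-] := gen_surj S h; exists (size w); apply/asboolP; exists w. Qed.

Definition word_len h := ex_minn (word_len_ex h).

Lemma word_lenP h : exists2 w, size w = word_len h & eval w = h.
Proof. by rewrite /word_len; case: ex_minnP => m /asboolP. Qed.

Lemma word_len_leq w : word_len (eval w) <= size w.
Proof. by rewrite /word_len; case: ex_minnP => m _; apply; apply/asboolP; exists w. Qed.

Lemma word_lenM g h : word_len (g * h)%g <= word_len g + word_len h.
Proof.
have [w <- <-] := word_lenP g; have [u <- <-] := word_lenP h.
by rewrite -word_eval_cat -size_cat word_len_leq.
Qed.

Lemma word_lenV h : word_len (h^-1)%g <= word_len h.
Proof.
have [w <- <-] := word_lenP h; rewrite -word_eval_inverse.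
by apply: leq_trans (word_len_leq _) _; rewrite size_rev size_map.
Qed.

Lemma word_len_letter h l : word_len h <= (word_len (h * leval l)%g).+1.
Proof.
rewrite -{1}(mulgK (leval l) h) -letter_evalN -addn1.
apply: leq_trans (word_lenM _ _) _; rewrite leq_add2l -word_eval1.
exact: (word_len_leq [:: _]).
Qed.

Lemma word_len_pred h : 0 < word_len h -> exists l, word_len (h * leval l)%g < word_len h.
Proof.
have [w <- <-] := word_lenP h; case/lastP: w => [//|w l] _.
exists (l.1, ~~ l.2); rewrite -cats1 word_eval_cat word_eval1 letter_evalN mulgK.
by rewrite size_cat addn1 ltnS word_len_leq.
Qed.

(** Some letter shortens a nontrivial element, and no letter shortens by more than one; so the
    descent meets every smaller length. *)
Lemma word_len_descend h c : c <= word_len h ->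
  exists2 u, word_len (h * u)%g = c & word_len u <= word_len h - c.
Proof.
move=> ch; have [d hd] : exists d, word_len h - c = d by exists (word_len h - c).
elim: d h ch hd => [|d IH] h ch hd.
  exists 1%g; first by rewrite mulg1; lia.
  by rewrite -(word_eval_nil (gen S)) (leq_trans (word_len_leq _)).
have [|l hl] := @word_len_pred h; first by lia.
have hl' := word_len_letter h l.
have [||u hu ud] := IH (h * leval l)%g; [lia|lia|].
exists (leval l * u)%g; first by rewrite mulgA.
apply: leq_trans (word_lenM _ _) _; rewrite -word_eval1.
have := word_len_leq [:: l]; rewrite /=; lia.
Qed.

Lemma word_len_onto : infinite_set [set: H] -> forall m, exists h, word_len h = m.
Proof.
move=> infH m; have [h mh] : exists h, m <= word_len h.
  apply: contrapT => nh; apply: infH.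
  apply: (@sub_finite_set _ _ (eval @` [set` word_ball (rank S) m])); last first.
    exact/finite_image/finite_seq.
  move=> h _; have [w wh <-] := word_lenP h; exists w => //=.
  rewrite mem_word_ball wh leqNgt; apply/negP => mh; apply: nh; exists h; exact: ltnW.
by have [u <- _] := word_len_descend mh; exists (h * u)%g.
Qed.

End WordLength.

Section Subshift.
Variables (H : groupType) (S : fin_gen H).
Let word := seq (letter (rank S)).
Local Notation eval := (word_eval (gen S)).
Local Notation leval := (letter_eval (gen S)).
Implicit Types (P : set (nat -> bool)) (x : config H (symbol (rank S))) (w u : word).

Definition based_at x (g : H) : word -> symbol (rank S) := fun w => x (g * eval w)%g.

Definition coding_subshift P : set (config H (symbol (rank S))) :=
  [set x | forall g, P (decode (based_at x g))].

Lemma coding_subshift_subshift P : Pi01 P -> is_subshift (coding_subshift P).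
Proof.
case=> W _ ->; split; last first.
  move=> g x Xx h; have := Xx (g^-1 * h)%g; congr (_ (decode _)); apply/funext => w.
  by rewrite /based_at /shift_config mulgA.
apply: closed_agree => x h g n.
have [y Xy xy] := h [seq (g * eval w)%g | w <- word_ball (rank S) (13 * 2 ^ n)].
have -> : mkseq (decode (based_at x g)) n = mkseq (decode (based_at y g)) n.
  apply/eq_in_map => i; rewrite mem_iota add0n => /andP[_ i_n]; apply: decode_local => w wi.
  apply: xy; apply: map_f; rewrite mem_word_ball (leq_trans wi) // leq_mul2l /=.
  by rewrite leq_exp2l // ltnW.
exact: Xy.
Qed.

Local Existing Instance enc_fin | 100.

(** Membership is the absence of violations [F q m], where m codes i, j, s: bit i is not that of a
    proper coding; or by stage s the i-th and j-th words are seen to be equal in H but carry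
    distinct letters; or by stage s the first j bits decoded from the i-th word are seen to leave P.
    Equality in H only has to be enumerated. *)
Lemma coding_subshift_effective P :
  Pi01 P -> recursively_presented S -> is_effective S (coding_subshift P).
Proof.
move=> P1 /re_Kleene[R [rR RP _]]; split; first exact: coding_subshift_subshift.
have [T [rT PT _]] := Pi01_stages P1.
pose e i : word := val (enum_free S i).
pose at_ (q : nat -> bool) w := letter_at (A := symbol (rank S)) None q w.
have ra (B : Type) (eB : Enc B) (f : (nat -> bool) -> B -> word) :
  recursive f -> recursive (fun o b => at_ o (f o b)) by apply: rec_letter_at.
have re (B : Type) (eB : Enc B) (f : (nat -> bool) -> B -> nat) :
  recursive f -> recursive (fun o b => e (f o b)) by apply: rec_enum_free.
pose F (q : nat -> bool) (m : nat) := let i := nfst m in let j := nfst (nsnd m) in let s :=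
  nsnd (nsnd m) in
  [|| q i != word_coding (S := S) (at_ q) i,
      R (word_code (inverse_word (e i) ++ e j)) s && (at_ q (e i) != at_ q (e j))
    | T (mkseq (decode (fun w => at_ q (e i ++ w))) j) s].
have rF : recursive F.
  rewrite /F /=; apply: rec_orb; last apply: rec_orb; last 1 first.
  - apply: (rec_comp2 (F := fun _ => T) rT); last by rec.
    apply: (rec_mkseq (g := fun q m => decode (fun w => at_ q (e (nfst m) ++ w)))); first by rec.
    apply: (rec_decode (f := fun q (p : nat * nat) w => at_ q (e (nfst p.1) ++ w))); last by rec.
    by apply: ra; apply: rec_cat; [apply: re; rec|rec].
  - apply: rec_negb; apply: rec_eqbool; first by rec.
    apply: (rec_comp (F := fun q => word_coding (S := S) (at_ q))); last by rec.
    by apply: rec_word_coding; apply: ra; rec.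
  - apply: rec_andb.
      apply: (rec_comp2 (F := fun _ => R) rR); last by rec.
      apply: rec_word_code; apply: rec_cat; last by apply: re; rec.
      by apply: rec_inverse_word; apply: re; rec.
    by apply: rec_negb; apply: rec_eq_fin; apply: ra; apply: re; rec.
have -> : coded S (coding_subshift P) = [set q | forall m, ~~ F q m];
  last exact: Pi01_of_recursive.
have eonto w : exists i, e i = reduce w by exists (free_index (S := S) w); rewrite /e free_indexP.
apply/seteqP; split=> q.
  move=> /[dup] /(coded_letter_at None)[x Xx qx] /codedP[y _ qy] m /=.
  apply/norP; split; last (apply/norP; split).
  - rewrite negbK {1}qy; apply/eqP; congr (word_coding (S := S) _ _); apply/funext => w.
    by rewrite /at_ qy letter_at_coding word_eval_reduce.
  - apply/negP => /andP[Rs]; have /RP[w w1] :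
    exists s, R (word_code (inverse_word (e (nfst m)) ++ e (nfst (nsnd m)))) s by eexists;
      exact: Rs.
    move=> /enc_word_inj we; move: w1; rewrite we /= word_eval_cat word_eval_inverse.
    by move=> /(congr1 (fun z => (eval (e (nfst m)) * z)%g));
      rewrite mulVKg mulg1 /at_ !qx => ->; rewrite eqxx.
  - have := Xx (eval (e (nfst m))); rewrite PT => /(_ (nfst (nsnd m)) (nsnd (nsnd m))).
    congr (~~ T _ _); apply/eq_map => n; congr decode; apply/funext => w.
    by rewrite /at_ qx word_eval_cat.
move=> h.
have h1 n : q n = word_coding (S := S) (at_ q) n.
  by have := h (npair n 0); rewrite /F nfst_pair => /norP[/negbNE/eqP].
have h2 w u : eval w = eval u -> at_ q w = at_ q u.
  move=> wu; have [i ei] := eonto w; have [j ej] := eonto u.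
  have /RP[s Rs] : word_problem S (word_code (inverse_word (e i) ++ e j)).
    exists (inverse_word (e i) ++ e j) => //=.
    by rewrite word_eval_cat word_eval_inverse ei ej !word_eval_reduce wu mulVg.
  have := h (npair i (npair j s)); rewrite /F !(nfst_pair, nsnd_pair) Rs /=.
  move=> /norP[_ /norP[/negbNE /eqP + _]].
  have red v : at_ q (reduce v) = at_ q v.
    rewrite /at_ /letter_at; congr block_letter; rewrite /free_index; apply: eq_ex_minn => n.
    by rewrite /free_index_pred (reduce_id (reduce_reduced v)).
  by rewrite ei ej !red.
have wordof g : exists w, eval w = g by exact: gen_surj.
(* Any word for g may be chosen: [h2] shows that the letter depends only on its value. *)
pose x : config H (symbol (rank S)) := fun g => at_ q (sval (cid (wordof g))).
have xq w : x (eval w) = at_ q w by rewrite /x; case: cid => u /= /h2.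
apply/codedP; exists x; last first.
  by apply/funext => n; rewrite h1; congr (word_coding (S := S) _ _); apply/funext => w;
    rewrite xq.
move=> g; rewrite PT => n s; have [w <-] := wordof g; have [i ei] := eonto w.
have := h (npair i (npair n s)); rewrite /F !(nfst_pair, nsnd_pair).
move=> /norP[_ /norP[_]]; congr (~~ T _ _); apply/eq_map => m; congr decode; apply/funext => u.
by rewrite /based_at -(word_eval_reduce _ w) -ei -word_eval_cat xq.
Qed.

Lemma coding_subshift_ge P : medvedev_le P (coded S (coding_subshift P)).
Proof.
pose at_ (q : nat -> bool) w := letter_at (A := symbol (rank S)) None q w.
apply: (@medvedev_le_rec _ _ (fun q => decode (at_ q))).
  apply: (rec_decode (f := fun q (_ : nat) => at_ q)); last by rec.
  by apply: rec_letter_at; rec.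
move=> q /(coded_letter_at None)[x Xx qx]; have := Xx 1%g; congr (P (decode _)).
by apply/funext => w; rewrite /based_at mul1g /at_ qx.
Qed.

End Subshift.

(** * Ruler configurations *)

Lemma logn2_mul_odd j m : odd m -> logn 2 (2 ^ j * m) = j.
Proof.
move=> om; have m0 := odd_gt0 om.
by rewrite lognM ?expn_gt0 // pfactorK // lognE dvdn2 om !andbF addn0.
Qed.

(* Among two consecutive multiples of 2^(j+1), one has 2-adic valuation j+1. *)
Lemma ruler_test j d : 3 * 2 ^ j < d -> 2 ^ j %| d ->
  (odd (logn 2 (d - 2 ^ j)) == odd j) && (odd (logn 2 (d - 3 * 2 ^ j)) == odd j) = (2 ^ j.+1 %|
    d).
Proof.
move=> m3 /dvdnP[m dm]; move: m3; rewrite {}dm ltn_pmul2r ?expn_gt0 // => m3.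
rewrite -[X in _ - X]mul1n -!mulnBl ![_ * 2 ^ j]mulnC expnS [2 * _]mulnC dvdn_pmul2l ?expn_gt0
  // dvdn2.
have [om|em] := boolP (odd m); last first.
  by rewrite !logn2_mul_odd ?eqxx // oddB ?(negbTE em) //; lia.
pose a := m./2; have ma : m = a.*2.+1 by rewrite /a -{1}(odd_double_half m) om.
have a2 : 1 < a by lia.
have -> : m - 1 = 2 * a by lia.
have -> : m - 3 = 2 * a.-1 by lia.
rewrite !mulnA -!expnSr.
have [oa|ea] := boolP (odd a).
  by rewrite logn2_mul_odd //=; case: (odd j).
rewrite [X in _ && X](_ : _ = false) ?andbF // logn2_mul_odd /=; first by case: (odd j).
by case: a a2 ea {ma} => //= a _; rewrite negbK.
Qed.

Section Ruler.
Variables (H : groupType) (S : fin_gen H).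
Let word := seq (letter (rank S)).
Local Notation eval := (word_eval (gen S)).
Local Notation leval := (letter_eval (gen S)).
Local Notation len := (word_len S).
Implicit Types (g h : H) (w u : word) (p : nat -> bool).

Definition ruler_config p : config H (symbol (rank S)) := fun h =>
  foldr (fun l a => if len (h * leval l)%g < len h
                    then Some (l, (odd (logn 2 (len h)), p (logn 2 (len h)))) else a)
    None (enum (letter (rank S) : finType)).

Lemma ruler_configP p h :
  if 0 < len h then
    exists2 l, (len (h * leval l)%g).+1 = len h
      & ruler_config p h = Some (l, (odd (logn 2 (len h)), p (logn 2 (len h))))
  else ruler_config p h = None.
Proof.
rewrite /ruler_config; case: posnP => h0.
  by elim: (enum _) => //= l s ->; rewrite h0.
have [l lh] := word_len_pred h0.
have : l \in enum (letter (rank S) : finType) by rewrite mem_enum.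
elim: (enum _) => //= l' s IH; rewrite inE; case: ifP => l'h; last first.
  by case: eqP => [ll'|_ /IH //]; rewrite -ll' lh in l'h.
move=> _; exists l' => //; apply/eqP; rewrite eqn_leq l'h; exact: word_len_letter.
Qed.

Section Walk.
Variables (p : nat -> bool) (g : H).
Let f := based_at (S := S) (ruler_config p) g.

(** Every pointer shortens by exactly one and the walk rests at the identity, which is what
    truncated subtraction expresses. *)
Lemma walk_ruler w i : len (g * eval (walk f w i))%g = len (g * eval w)%g - i.
Proof.
elim: i => [|i IH]; first by rewrite subn0.
rewrite /walk iterS -/(walk f w i) subnS -IH /next /f /based_at.
have := ruler_configP p (g * eval (walk f w i))%g; rewrite /f /based_at;
  case: posnP => [h0 ->|h0 [l hl ->]].
  by rewrite h0.
by rewrite -cats1 word_eval_cat word_eval1 mulgA -hl.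
Qed.

Lemma based_at_ruler w : f w = ruler_config p (g * eval w)%g.
Proof. by []. Qed.

Lemma marked_ruler b w i :
  marked b (f (walk f w i)) =
    (i < len (g * eval w)%g) && (odd (logn 2 (len (g * eval w)%g - i)) == b).
Proof.
have := ruler_configP p (g * eval (walk f w i))%g; rewrite walk_ruler subn_gt0.
by rewrite based_at_ruler; case: ltnP => [_ [l _ ->]|_ ->].
Qed.

Lemma isSome_ruler w i : isSome (f (walk f w i)) = (i < len (g * eval w)%g).
Proof.
have := ruler_configP p (g * eval (walk f w i))%g; rewrite walk_ruler subn_gt0.
by rewrite based_at_ruler; case: ltnP => [_ [l _ ->]|_ ->].
Qed.

Lemma bit_ruler w : 0 < len (g * eval w)%g -> bit (f w) = p (logn 2 (len (g * eval w)%g)).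
Proof.
by move=> w0; have := ruler_configP p (g * eval w)%g; rewrite w0 based_at_ruler => -[l _ ->].
Qed.

Lemma level_test_ruler w j : 3 * 2 ^ j < len (g * eval w)%g -> 2 ^ j %| len (g * eval w)%g ->
  level_test f w j = (2 ^ j.+1 %| len (g * eval w)%g).
Proof.
move=> jw jd; rewrite /level_test !marked_ruler jw -ruler_test //=.
by rewrite (leq_ltn_trans _ jw) // leq_pmull.
Qed.

(** The [isSome] conjunct ensures that the path is longer than 3 * 2^n, so a failing last test
    speaks of the valuation and not of a path that has ended. The tests below n then certify
    divisibility one power at a time. *)
Lemma at_level_ruler n w : at_level f n w =
  (3 * 2 ^ n < len (g * eval w)%g) && (logn 2 (len (g * eval w)%g) == n).
Proof.
set d := len _; rewrite /at_level isSome_ruler -/d.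
case: (ltnP (3 * 2 ^ n) d) => nd; last by rewrite andbF.
have nj j : j <= n -> 3 * 2 ^ j < d.
  by move=> jn; apply: leq_ltn_trans nd; rewrite leq_mul2l leq_exp2l.
have d0 : 0 < d by apply: leq_ltn_trans nd.
have alln m : m <= n -> all (level_test f w) (iota 0 m) = (2 ^ m %| d).
  elim: m => [|m IH] mn; first by rewrite dvd1n.
  rewrite -addn1 iotaD all_cat add0n /= andbT IH 1?ltnW // addn1.
  have [md|nmd] := boolP (2 ^ m %| d); first by rewrite level_test_ruler // nj // ltnW.
  by apply/esym/negP => h; move/negP: nmd; apply; apply: dvdn_trans h; rewrite dvdn_exp2l.
rewrite alln // andbT; have [dn|ndn] /= := boolP (2 ^ n %| d).
  rewrite level_test_ruler ?nj // -/d pfactor_dvdn //.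
  by move: dn; rewrite pfactor_dvdn // -leqNgt => dn; rewrite [RHS]eqn_leq dn andbT.
by apply/esym/negP => /eqP e; move/negP: ndn; apply; rewrite pfactor_dvdn // e.
Qed.

Lemma decode_ruler : infinite_set [set: H] -> decode f = p.
Proof.
move=> infH; apply/funext => n; rewrite /decode.
set L := word_ball _ _; set w := nth _ _ _.
suff hL : has (at_level f n) L.
  have := nth_find [::] hL; rewrite -/w at_level_ruler => /andP[wn /eqP ln].
  by rewrite bit_ruler ?ln // (leq_ltn_trans _ wn).
have [u gu lu] : exists2 u, (3 * 2 ^ n < len (g * u)%g) && (logn 2 (len (g * u)%g) == n)
    & len u <= 10 * 2 ^ n.
  have t0 : 0 < 2 ^ n by rewrite expn_gt0.
  have [gn|gn] := leqP (5 * 2 ^ n) (len g).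
    (* Far from the identity: descend to the largest odd multiple of 2^n not above the length of g.
       It is at least 5 * 2^n, and less than 2 * 2^n is lost. *)
    pose q := (len g - 2 ^ n) %/ (2 * 2 ^ n).
    have := divn_eq (len g - 2 ^ n) (2 * 2 ^ n); rewrite -/q.
    have : (len g - 2 ^ n) %% (2 * 2 ^ n) < 2 * 2 ^ n by rewrite ltn_mod muln_gt0.
    move: (_ %% _) => r rn qr.
    have q2 : 1 < q by rewrite /q leq_divRL ?muln_gt0 //; lia.
    have cg : 2 ^ n * q.*2.+1 <= len g by lia.
    have [u hu ul] := word_len_descend cg.
    exists u; last by lia.
    by rewrite hu logn2_mul_odd ?eqxx /= ?odd_double // mulnC ltn_pmul2l // andbT; lia.
  (* Near the identity the paths may be too short: move to any element of length 5 * 2^n, which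
     exists because H is infinite. *)
  have [z hz] := word_len_onto S infH (5 * 2 ^ n).
  exists (g^-1 * z)%g; last first.
    apply: (leq_trans (word_lenM S _ _)); rewrite hz.
    by have := word_lenV S g; move: gn; move: (len g^-1%g) (len g) (2 ^ n) => a b c; lia.
  by rewrite mulVKg hz [5 * _]mulnC logn2_mul_odd // eqxx andbT mulnC ltn_pmul2l.
have [v vu ve] := word_lenP S u.
apply/hasP; exists v; first by rewrite mem_word_ball vu.
by rewrite at_level_ruler ve.
Qed.

End Walk.

Lemma ruler_config_coding (P : set (nat -> bool)) p :
  infinite_set [set: H] -> P p -> coding_subshift (S := S) P (ruler_config p).
Proof. by move=> infH Pp g; rewrite decode_ruler. Qed.

Local Existing Instance enc_fin | 100.

Lemma find_iota0 (a : nat -> bool) n m :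
  m <= n -> (forall i, i < m -> ~~ a i) -> (m < n -> a m) -> find a (iota 0 n) = m.
Proof.
move=> mn nai am; rewrite -(subnKC mn) iotaD find_cat ifF; last first.
  by apply/hasPn => i; rewrite mem_iota add0n; apply: nai.
rewrite size_iota; case E : (n - m) => [|d] /=; first by rewrite addn0.
by rewrite am ?addn0 //; lia.
Qed.

(** A decidable word problem makes word lengths computable. The pointers and parities of the ruler
    configuration follow, and the valuation tells which bit of p to query. *)
Lemma coding_subshift_le (P : set (nat -> bool)) :
  infinite_set [set: H] -> has_decidable_word_problem S ->
    medvedev_le (coded S (coding_subshift (S := S) P)) P.
Proof.
move=> infH wpS; pose D n := `[< word_problem S n >].
have rD : recursive (fun _ n => D n) by apply: rec_unraw; exact: (rec_of_computable wpS).
have DP w u : D (word_code (inverse_word w ++ u)) = (eval w == eval u).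
  apply/asboolP/eqP => [[v v1 /enc_word_inj vwu]|wu].
    move: v1; rewrite vwu /= word_eval_cat word_eval_inverse => /(congr1 (fun z => eval w * z)%g).
    by rewrite mulVKg mulg1.
  by exists (inverse_word w ++ u) => //=; rewrite word_eval_cat word_eval_inverse wu mulVg.
(* The search stops before [size w]; if it fails, [find] returns [size w], which is then the
   length. *)
pose lenw (w : word) := find (fun m => has (fun u =>
  D (word_code (inverse_word w ++ u))) (word_ball (rank S) m))
   (iota 0 (size w)).
have lenwE w : lenw w = len (eval w).
  apply: find_iota0; first exact: word_len_leq.
    move=> i il; apply/hasPn => u; rewrite mem_word_ball DP => ui.
    apply/negP => /eqP wu; move: il; rewrite wu ltnNge.
    by rewrite (leq_trans (word_len_leq u)).
  move=> _; have [u ul ue] := word_lenP S (eval w).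
  by apply/hasP; exists u; rewrite ?mem_word_ball ?ul // DP ue.
have rlen (B : Type) (eB : Enc B) (f : (nat -> bool) -> B -> word) :
    recursive f -> recursive (fun o b => lenw (f o b)).
  move=> rf; apply: (rec_comp (F := fun _ => lenw)) rf.
  apply: rec_find_iota; first by rec.
  apply: rec_has; last by apply: rec_word_ball; rec.
  apply: (rec_comp (F := fun _ => D) rD); apply: rec_word_code; apply: rec_cat; last by rec.
  by apply: rec_inverse_word; rec.
(* This is [ruler_config] on words, with the four labels spelled out: they become constants, and
   only the tests involve lengths and the oracle. *)
pose M (q : nat -> bool) (w : word) : symbol (rank S) :=
  foldr (fun l a => if lenw (rcons w l) < lenw w
     then (if odd (logn 2 (lenw w)) then (if q (logn 2 (lenw w)) then Some (l, (true, true))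
       else Some (l, (true, false)))
           else (if q (logn 2 (lenw w)) then Some (l, (false, true)) else Some (l, (false,
             false)))) else a)
    None (enum (letter (rank S) : finType)).
have rM : recursive M.
  rewrite /M; elim: (enum _) => [|l s IH] /=; first exact: rec_cst.
  have r1 : recursive (fun (_ : nat -> bool) (w : word) => lenw w) by apply: rlen; rec.
  have r2 : recursive (fun (_ : nat -> bool) (w : word) => lenw (rcons w l)) by apply: rlen; rec.
  by rec.
apply: (coded_le rM) => p Pp; exists (ruler_config p); first exact: ruler_config_coding.
move=> w; rewrite /M /ruler_config; elim: (enum _) => //= l s ->.
rewrite !lenwE -cats1 word_eval_cat word_eval1; case: ifP => // _.
by case: odd; case: (p _).
Qed.

End Ruler.

(** * Pullbacks along an epimorphism preserve the degree *)

Section Simulation.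
Variables (G H : groupType) (SG : fin_gen G) (SH : fin_gen H).
Variables (rho : {multiplicative G -> H}) (A : finType) (X : set (config H A)).

Lemma morph1 : rho 1%g = 1%g.
Proof. by apply: (@mulgI _ (rho 1%g)); rewrite -gmulfM !mulg1. Qed.

(** Each letter of G is replaced by a fixed word of H for its image: a finite table, hence a
    computable translation. *)
Lemma pullback_le : X !=set0 -> medvedev_le (coded SG (pullback rho X)) (coded SH X).
Proof.
move=> X0.
have ht (l : letter (rank SG)) : exists w, word_eval (gen SH) w = rho (letter_eval (gen SG) l).
  exact: gen_surj.
pose t l := sval (cid (ht l)).
apply: (@medvedev_le_translate _ _ _ _ _ t) => // x Xx.
exists (x \o rho); first by exists x.
move=> w; congr (x _); rewrite (word_eval_translate (h := rho \o letter_eval (gen SG))).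
  by rewrite /word_eval (big_morph rho (@gmulfM _ _ rho) morph1).
by move=> l; rewrite /t; case: cid.
Qed.

(** Each letter of H is lifted to a fixed word of G above it. A point of the pullback is constant on
    the fibres of [rho], so reading it at lifted words recovers the point of X. *)
Lemma pullback_ge : (forall h, exists g, rho g = h) -> X !=set0 ->
  medvedev_le (coded SH X) (coded SG (pullback rho X)).
Proof.
move=> rho_surj [x0 Xx0].
have ht (l : letter (rank SH)) : exists w, rho (word_eval (gen SG) w) = letter_eval (gen SH) l.
  by have [g <-] := rho_surj (letter_eval (gen SH) l); have [w <-] := gen_surj SG g; exists w.
pose t l := sval (cid (ht l)).
apply: (@medvedev_le_translate _ _ _ _ _ t); first by exists (fun g => x0 (rho g)); exists x0.
move=> _ [x Xx <-]; exists x => // w; congr (x _).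
elim: w => [|l w IH]; first by rewrite !word_eval_nil morph1.
rewrite /translate /= word_eval_cat -/(translate t w) gmulfM IH word_eval_cons; congr (_ * _)%g.
by rewrite /t; case: cid.
Qed.

End Simulation.

Theorem proposition5p14 (G H : groupType) (SG : fin_gen G) (SH : fin_gen H)
    (sim : simulates G SH) :
  [/\ M_EFF SH `<=` M_SOF SG,
      infinite_set [set: H] -> recursively_presented SH ->
        exists2 dmax, is_maximal_Pi01_degree dmax
          & exists2 d, M_SFT SG d & degree_le dmax d
    & infinite_set [set: H] -> has_decidable_word_problem SH ->
        Pi01_degrees `<=` M_SOF SG].
Proof.
case: sim => rho rho_surj sim.
have pull0 (A : finType) (X : set (config H A)) : X !=set0 -> pullback rho X !=set0.
  by case=> x Xx; exists (fun g => x (rho g)); exists x.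
have pullE (A : finType) (X : set (config H A)) : X !=set0 ->
    subshift_degree SH X = subshift_degree SG (pullback rho X).
  by move=> X0; apply: degree_of_eq; [exact: pullback_ge|exact: pullback_le].
split.
- move=> _ [A [X [X0 Xeff ->]]]; exists A, (pullback rho X).
  by split; [exact: pull0|exact: sim|exact: pullE].
- move=> infH rpH; exists (degree_of diagonal_class); first exact: diagonal_class_degree.
  pose X := coding_subshift (S := SH) diagonal_class.
  have X0 : X !=set0.
    have [p Qp] := diagonal_class_neq0.
    by exists (ruler_config SH p); apply: ruler_config_coding.
  have [_ [B [Y [phi [Ysft phiC phiE Xphi]]]]] :=
    sim _ _ (coding_subshift_effective diagonal_class_Pi01 rpH).
  have Y0 : Y !=set0.
    by have [z] := pull0 _ _ X0; rewrite Xphi => -[y Yy _]; exists y.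
  exists (subshift_degree SG Y); first by exists B, Y.
  exists diagonal_class, (coded SG Y); split; [by split; apply: medvedev_le_refl|by split;
    apply: medvedev_le_refl|].
  (* The chain runs from the diagonal class to X, to its pullback, which is the image of Y under
     [phi], and finally to the SFT Y; the last step goes upwards only, so the degree of Y is merely
     bounded below. *)
  apply: medvedev_le_trans (coding_subshift_ge SH _) _.
  apply: medvedev_le_trans (pullback_ge SG SH rho_surj X0) _.
  by rewrite Xphi; apply: factor_le.
- move=> infH wpH _ [P [P1 [p Pp]] <-].
  have X0 : coding_subshift (S := SH) P !=set0 by exists (ruler_config SH p);
    apply: ruler_config_coding.
  have rpH : recursively_presented SH by exact: decidable_re.
  exists _, (pullback rho (coding_subshift (S := SH) P)); split; first exact: pull0.
    exact/sim/coding_subshift_effective.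
  rewrite -pullE //; apply: degree_of_eq; [exact: coding_subshift_ge|exact: coding_subshift_le].
Qed.
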